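(* Let $p$ be an odd prime, $m$ an even positive integer, $n=2m$, $Q=p^{m/2}$, $\mathbb{M}=\mathbb{F}_{p^m}$, $\mathbb{L}=\mathbb{F}_{p^{m/2}}$. For $q=p^k$ with $1\le k\le m-1$ and $m/\gcd(k,m)$ odd, $B\in\mathbb{M}^\times$ a non-square, and $a\in\mathbb{L}^\times$, let $\mathbb{P}_{q,B,a}$ be the corresponding pre-semifield of Family $\mathcal{S}$, and let $\overline{q}=p^{m-k}$. Below, $q,q'$ range over admissible powers of $p$, $B,B'$ over non-squares of $\mathbb{M}^\times$, and $a,a'$ over $\mathbb{L}^\times$. Then: (i) $\mathbb{P}_{q,B,a}$ and $\mathbb{P}_{q',B',a'}$ are isotopic if and only if they are strongly isotopic. (ii) $\mathbb{P}_{q,B,a}$ is isotopic to $\mathbb{P}_{\overline{q},B,a'}$ with $a'=B^{Q+1}/a$, for all $q,B,a$. (iii) For all $q,B,B',a$ there is an $a'\in\mathbb{L}^\times$ such that $\mathbb{P}_{q,B,a}$ is isotopic to $\mathbb{P}_{q,B',a'}$. (iv) If $\mathbb{P}_{q,B,a}$ is isotopic to $\mathbb{P}_{q,B,a'}$, then it is also isotopic to $\mathbb{P}_{q,B,-a'}$. (v) For given $q,B,a$ there are at most $2m=n$ different $a'\in\mathbb{L}^\times$ such that $\mathbb{P}_{q,B,a}$ is isotopic to $\mathbb{P}_{q,B,a'}$. (vi) There are no other isotopisms within the family; that is, if $\mathbb{P}_{q,B,a}$ and $\mathbb{P}_{q',B',a'}$ are isotopic, then $q'\in\{q,\overline{q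}\}$.
   Context: Family $\mathcal{S}$: with $q=p^k$, $r=qQ=p^{k+m/2}$, $\mathbb{P}_{q,B,a}=(\mathbb{M}\times\mathbb{M},+,\ast)$ is the commutative pre-semifield with multiplication $$(x,y)\ast(u,v)=\bigl(x^qu+xu^q+B(y^qv+yv^q),\ x^{r}v+yu^{r}+\tfrac aB(xv^{r}+y^{r}u)\bigr),$$ i.e. the polarization of $F(x,y)=(x^{q+1}+By^{q+1},\,x^ry+\frac aB xy^r)$. A pre-semifield is a finite additive group with a multiplication that is left and right distributive and has no zero divisors. Two pre-semifields $(V,+,\circ_1)$, $(V,+,\circ_2)$ on the same $\mathbb{F}_p$-vector space $V$ are isotopic if there are $\mathbb{F}_p$-linear bijections $N,L,M$ of $V$ with $N(X\circ_1U)=L(X)\circ_2M(U)$ for all $X,U$; they are strongly isotopic if this is possible with $L=M$. *)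

(* Defs.v *)
From HB Require Import structures.
From mathcomp Require Import all_boot all_order all_algebra all_field.
Set Implicit Arguments.
Unset Strict Implicit.
Unset Printing Implicit Defensive.
Import GRing.Theory.
Local Open Scope ring_scope.

(* Isotopy of two multiplications on the same F-vector space V; it is meant   *)
(* to be used with F = 'F_p and pre-semifield multiplications.                *)
Definition isotopic (F : fieldType) (V : lmodType F) (mul1 mul2 : V -> V -> V)
    : Prop :=
  exists N L M : {linear V -> V},
    [/\ bijective N, bijective L, bijective M
      & forall X U : V, N (mul1 X U) = mul2 (L X) (M U)].

Definition strongly_isotopic (F : fieldType) (V : lmodType F)
    (mul1 mul2 : V -> V -> V) : Prop :=
  exists N L : {linear V -> V},
    [/\ bijective N, bijective L
      & forall X U : V, N (mul1 X U) = mul2 (L X) (L U)].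

(* Admissible exponents k; the corresponding admissible power is q = p ^ k.   *)
Definition admissible (m k : nat) : Prop :=
  [/\ (1 <= k)%N, (k <= m - 1)%N & odd (m %/ gcdn k m)].

Definition nonsquare (M : fieldType) (B : M) : Prop :=
  B != 0 /\ ~ (exists z : M, B = z ^+ 2).

(* The multiplication of P_{q,B,a} in Family S, where q = p ^ k, Q = p ^ (m/2) *)
(* and r = q Q; it is the polarization of                                     *)
(*   F (x, y) = (x ^ (q + 1) + B y ^ (q + 1), x ^ r y + (a / B) x y ^ r).     *)
Definition mulS (p m k : nat) (M : fieldType) (B a : M) (X U : M * M) : M * M :=
  let q := (p ^ k)%N in
  let Q := (p ^ m./2)%N in
  let r := (q * Q)%N in
  let: (x, y) := X in
  let: (u, v) := U in
  (x ^+ q * u + x * u ^+ q + B * (y ^+ q * v + y * v ^+ q),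
   x ^+ r * v + y * u ^+ r + a / B * (x * v ^+ r + y ^+ r * u)).

(* Main.v *)
Require Import Defs.
From HB Require Import structures.
From mathcomp Require Import all_boot all_order all_algebra all_field.
From mathcomp Require Import cyclic ring zify.
Set Implicit Arguments.
Unset Strict Implicit.
Unset Printing Implicit Defensive.
Import GRing.Theory.
Local Open Scope ring_scope.

(** Extend scalars from F_p to M: the space M x M becomes the M-space whose
coordinates are all the Frobenius conjugates x ^ (p ^ i) and y ^ (p ^ i), with i
in Z/m, and the multiplication becomes very sparse.  Index a basis by a letter
s (x or y) and a position i, the positions of the letter y being shifted by
m/2.  The product of b(s,i) and b(t,j) vanishes unless j = i + k or j = i - k,
and it is then a multiple of a single basis vector ([star_delta_delta],
[emb_mulS]).  F_p-linear bijections of M x M extend to M-linear ones that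
commute with Frobenius ([additive_matrix], [matrix_frob]), so an isotopism
becomes one between two of these sparse algebras ([isotopism_extend]).

An isotopism preserves the rank of X * _.  Every plane spanned by b(x,i) and
b(y,i) or by b(x,i) and b(y,i+m/2) consists of vectors of rank at most 4.
Conversely a vector of rank at most 4 lies in such a plane ([rank_le4_support],
[rank_le4_twins]); the only other candidates would need
a ^ (q+1) = B ^ (q(Q+1)), which is impossible because B is not a square
([norm_not_twisted_square]).  Each basis line is the intersection of two of
these planes, hence basis lines go to basis lines ([column_monomial]).  By the
Frobenius equivariance, each component of the two maps on the operands is thus
a single term c x ^ (p ^ r) or c y ^ (p ^ r).  Looking at which products vanish shows that
all the exponents r agree and that k' = k or k' = m - k ([shifts_equal]); this
is (vi).

Suppose that k' = k.  The ratio e of the two linear maps of an isotopism is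
fixed by the q-power map.  Writing e / e ^ Q = s ^ 2, where s is fixed by the
q-power map and has norm 1 or -1 over L, one can move s into the other
coefficients ([rescaling_up_to_sign]).  What remains is a scalar t with
t ^ (q+1) B = B' ^ (p ^ r) and with t ^ (qQ) (a / B) equal, up to sign, to
t (a' / B') ^ (p ^ r); if the isotopism exchanges x and y, then B and a / B are
to be inverted.  For non-square B, the twist by the Q-power map realizes the
opposite of a ([rescaling_conj]); this gives (iv) and removes the sign.  Such a
t is a strong isotopism, whence (i), the case k' = m - k being reduced to
k' = k by the explicit strong isotopism [mulS_dual] of (ii).  Since t ^ (q+1)
determines t up to sign, a' is determined by r and by whether x and y are
exchanged, which leaves 2m values: this is (v).  Finally (iii) holds because
the (q+1)-th powers are exactly the squares ([expq1_surj]). *)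

(** * Square matrices acting on coordinate functions *)

Section MatrixAction.
Variables (F : fieldType) (I : finType).
Implicit Types (A : I -> I -> F) (X Y : I -> F).

(** Matrices and vectors are plain functions, so that the index set can be any
finite type and coordinates can be computed without enumerating it. *)
Definition apply_mx A X : I -> F := fun i => \sum_j A i j * X j.
Definition delta (j : I) : I -> F := fun i => (i == j)%:R.

Lemma apply_delta A j : apply_mx A (delta j) =1 A^~ j.
Proof.
move=> i; rewrite /apply_mx (bigD1 j) //= /delta eqxx mulr1.
by rewrite big1 ?addr0 // => l /negPf->; rewrite mulr0.
Qed.

Lemma sum_delta (X : I -> F) i : \sum_j X j * delta j i = X i.
Proof.
rewrite (bigD1 i) //= /delta eqxx mulr1 big1 ?addr0 // => j.
by rewrite eq_sym => /negPf->; rewrite mulr0.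
Qed.

Lemma apply_ext A X Y : X =1 Y -> apply_mx A X =1 apply_mx A Y.
Proof. by move=> eXY i; apply: eq_bigr => j _; rewrite eXY. Qed.

Lemma apply_comb A (J : finType) (d : J -> F) (z : J -> I -> F) X :
    (forall i, X i = \sum_j d j * z j i) ->
  forall i, apply_mx A X i = \sum_j d j * apply_mx A (z j) i.
Proof.
move=> defX i; rewrite /apply_mx.
under eq_bigr => l _ do rewrite defX mulr_sumr.
rewrite exchange_big /=; apply: eq_bigr => j _; rewrite mulr_sumr.
by apply: eq_bigr => l _; rewrite mulrCA.
Qed.

(** If C K is an invertible diagonal matrix, then K is invertible too. *)
Lemma diagonal_minor_inj (J : finType) (C K : J -> J -> F) (D : J -> F) (e : J -> F) :
    (forall i j, \sum_l C i l * K l j = if i == j then D i else 0) ->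
    (forall j, D j != 0) -> (forall j, \sum_l e l * K l j = 0) ->
  forall j, e j = 0.
Proof.
move=> CK Dn0 eK j.
pose mC := \matrix_(a < #|J|, b < #|J|) C (enum_val a) (enum_val b).
pose mK := \matrix_(a < #|J|, b < #|J|) K (enum_val a) (enum_val b).
pose me := \row_(a < #|J|) e (enum_val a).
have sumE (f : J -> F) : \sum_(b < #|J|) f (enum_val b) = \sum_l f l.
  rewrite (reindex (fun b : 'I_#|J| => enum_val b)) //=.
  by apply: onW_bij; exact: enum_val_bij.
have mCK : mC *m mK = diag_mx (\row_a D (enum_val a)).
  apply/matrixP=> a b; rewrite !mxE.
  under eq_bigr => l _ do rewrite !mxE.
  rewrite (sumE (fun l => C (enum_val a) l * K l (enum_val b))) CK.
  by rewrite (inj_eq enum_val_inj); case: (a =P b) => [->|_]; rewrite ?mulr1n ?mulr0n.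
have Kunit : mK \in unitmx.
  have: mC *m mK \in unitmx.
    rewrite mCK unitmxE det_diag unitfE prodf_seq_neq0; apply/allP=> a _.
    by rewrite !mxE /= Dn0.
  by rewrite unitmx_mul => /andP[].
have: me *m mK = 0.
  apply/rowP=> b; rewrite !mxE; under eq_bigr => l _ do rewrite !mxE.
  by rewrite (sumE (fun l => e l * K l (enum_val b))) eK.
move/(congr1 (mulmx^~ (invmx mK))); rewrite mulmxK // mul0mx => /rowP/(_ (enum_rank j)).
by rewrite !mxE enum_rankK.
Qed.

End MatrixAction.
Arguments delta {F I}.

(** * The sparse multiplication and its products of basis vectors *)

Section TwinStar.
Variables (F : fieldType) (Z : finComNzRingType) (h : Z).
Notation G := (bool * Z)%type.
Implicit Types (c : bool -> bool -> Z -> F) (k : Z) (X U : G -> F).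

(** The commutative product with b(s,j) * b(t,j+k) = c s t j b'(s+t, j+h s), the
other products of basis vectors being zero.  Letters are Booleans added by
exclusive or, and h is an element of order 2.  When no c s t j vanishes,
b(false,j) and b(true,j) annihilate the same basis vectors. *)
Definition star c k X U : G -> F := fun wi =>
  \sum_(s : bool)
    let j := wi.2 + h *+ s in let t := s (+) wi.1 in
    c s t j * (X (s, j) * U (t, j + k) + X (t, j + k) * U (s, j)).

Lemma starC c k X U : star c k X U =1 star c k U X.
Proof. by move=> wi; apply: eq_bigr => s _ /=; ring. Qed.

Lemma starE c k X U w i : star c k X U (w, i) =
  c false w i * (X (false, i) * U (w, i + k) + X (w, i + k) * U (false, i)) +
  c true (~~ w) (i + h) * (X (true, i + h) * U (~~ w, i + h + k)
                       + X (~~ w, i + h + k) * U (true, i + h)).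
Proof. by rewrite /star big_bool /= addrC addr0. Qed.

Lemma star_ext c k X X' U U' : X =1 X' -> U =1 U' -> star c k X U =1 star c k X' U'.
Proof. by move=> eX eU wi; apply: eq_bigr => s _ /=; rewrite !eX !eU. Qed.

Lemma star_combr c k X (J : finType) (d : J -> F) (z : J -> G -> F) U :
    (forall i, U i = \sum_j d j * z j i) ->
  forall i, star c k X U i = \sum_j d j * star c k X (z j) i.
Proof.
move=> defU wi; rewrite /star.
under [RHS]eq_bigr => j _ do rewrite mulr_sumr.
rewrite exchange_big /=; apply: eq_bigr => s _; rewrite !defU mulrDr !mulr_sumr.
rewrite -big_split /= ?mulr_sumr; apply: eq_bigr => j _; ring.
Qed.

Hypotheses (h2 : h + h = 0) (h_neq0 : h != 0).

Lemma twistN (s : bool) : - (h *+ s) = h *+ s.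
Proof.
by apply/eqP; rewrite eq_sym -addr_eq0; case: s; rewrite /= ?mulr0n ?addr0 ?mulr1n ?h2.
Qed.

Lemma twistD (s t : bool) : h *+ s + h *+ t = h *+ (s (+) t).
Proof. by case: s; case: t; rewrite /= ?addr0 ?add0r ?mulr1n ?h2. Qed.

Lemma twistK (s : bool) x : x + h *+ s + h *+ s = x.
Proof. by rewrite -addrA twistD addbb addr0. Qed.

Lemma twist_inj (s t : bool) : (h *+ s == h *+ t) = (s == t).
Proof.
case: s; case: t; rewrite /= ?eqxx // ?mulr1n ?mulr0n ?(negPf h_neq0) //.
by rewrite eq_sym (negPf h_neq0).
Qed.

Lemma twist_eq l j (s : bool) : (l + h *+ s == j) = (l == j + h *+ s).
Proof. by rewrite -(inj_eq (addIr (h *+ s))) twistK. Qed.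

(** Row b(t,j) of the matrix of U |-> X * U: it sees X only at the positions
j - k and j + k. *)
Lemma star_delta c k X t j w l (s := w (+) t) :
  star c k X (delta (t, j)) (w, l) =
  (if l == j - k + h *+ s then c s t (j - k) * X (s, j - k) else 0)
  + (if l == j + h *+ t then c t s j * X (s, j + k) else 0).
Proof.
have -> : (if l == j - k + h *+ s then c s t (j - k) * X (s, j - k) else 0) =
    c s t (l + h *+ s) * X (s, l + h *+ s) * (l == j - k + h *+ s)%:R.
  by case: eqP => [->|_]; rewrite ?twistK ?mulr1 ?mulr0.
have -> : (if l == j + h *+ t then c t s j * X (s, j + k) else 0) =
    c t s (l + h *+ t) * X (s, l + h *+ t + k) * (l == j + h *+ t)%:R.
  by case: eqP => [->|_]; rewrite ?twistK ?mulr1 ?mulr0.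
rewrite starE /delta !xpair_eqE -!twist_eq.
have e x y : (x + k == y) = (x == y - k) by rewrite -subr_eq opprK.
rewrite {}/s !e; case: t; case: w; rewrite /= ?mulr0n ?mulr1n ?addr0;
  rewrite ?(mulr0, add0r, addr0); ring.
Qed.

(** The operator U |-> X * U has rank at most 4.  The four generators of its
image are indexed by pairs of Booleans to match the 2 + 2 natural ones. *)
Definition rank_le4 c k X := exists z : bool * bool -> G -> F,
  forall U, exists d : bool * bool -> F,
  forall l, star c k X U l = \sum_j d j * z j l.

(** Four operands V a with an invertible diagonal matrix of coordinates g b
already generate the image, so the coordinates g b separate its points. *)
Lemma rank_le4_vanish c k X (V : bool * bool -> G -> F) (g : bool * bool -> G)
    (D : bool * bool -> F) U :
    rank_le4 c k X ->
    (forall a b, star c k X (V a) (g b) = if a == b then D a else 0) ->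
    (forall a, D a != 0) -> (forall b, star c k X U (g b) = 0) ->
  star c k X U =1 fun=> 0.
Proof.
move=> [z z_span] diagV Dn0 Ug0 l.
have [C defC] := fin_all_exists (fun a => z_span (V a)).
have [d defd] := z_span U; rewrite defd big1 // => j _.
rewrite (@diagonal_minor_inj _ _ C (fun j b => z j (g b)) D d) ?mul0r //.
  by move=> a b; rewrite -defC diagV.
by move=> b; rewrite -defd Ug0.
Qed.

Hypothesis ker_double : forall x : Z, x + x = 0 -> x = 0 \/ x = h.

(** Doubling forgets multiples of h, so it tells positions apart whatever the
twists are. *)
Lemma twist_neq x (s t u : bool) l j :
  l - j = x + h *+ s - h *+ t - h *+ u -> x + x != 0 -> (l == j) = false.
Proof.
rewrite !twistN -!addrA !twistD => lj x2; apply/negP=> /eqP elj; case/negP: x2.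
move: lj; rewrite elj subrr => /esym/eqP; rewrite addr_eq0 twistN => /eqP->.
by rewrite twistD addbb.
Qed.

Lemma twist_eqD x (u v w : bool) :
  (x + h *+ u == x + h *+ v + h *+ w) = (u == v (+) w).
Proof. by rewrite -addrA (inj_eq (addrI _)) twistD twist_inj. Qed.

(** * Vectors of rank at most 4 *)

Section Support.
Variables (c : bool -> bool -> Z -> F) (k : Z).
Hypothesis c_neq0 : forall s t i, c s t i != 0.
Hypothesis k8_neq0 : k *+ 8 != 0.

Let k4_neq0 : (k + k) + (k + k) != 0.
Proof.
apply: contra k8_neq0 => /eqP e.
have -> : k *+ 8 = (k + k + (k + k)) + (k + k + (k + k)) by ring.
by rewrite e addr0.
Qed.
Let k2_neq0 : k + k != 0.
Proof. by apply: contra k4_neq0 => /eqP->; rewrite addr0. Qed.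
Let Nk2_neq0 : - k + - k != 0. Proof. by rewrite -opprD oppr_eq0. Qed.
Let Nk4_neq0 : - (k + k) + - (k + k) != 0. Proof. by rewrite -opprD oppr_eq0. Qed.

Section Coordinates.
Variables (X : G -> F) (i : Z) (t u v w : bool).

(** The four coordinates below are those of the products of X with b(t,i+k) and
b(t,i-k), up to twists, at positions i and i - k.  Both diagonal blocks involve
X only at position i and its twist, and the off-diagonal ones vanish. *)
Lemma star_up_up : star c k X (delta (t, i + k + h *+ v)) (w, i + h *+ u) =
  if u == v (+) (w (+) t) then c (w (+) t) t (i + h *+ v) * X (w (+) t, i + h *+ v)
  else 0.
Proof.
have e : i + k + h *+ v - k = i + h *+ v by ring.
rewrite star_delta e -addrA twistD (inj_eq (addrI _)) twist_inj.
have -> : (i + h *+ u == i + k + h *+ v + h *+ t) = false.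
  by rewrite (@twist_neq (- k) u v t) //; ring.
by rewrite addr0.
Qed.

Lemma star_up_down : star c k X (delta (t, i + k + h *+ v)) (w, i - k + h *+ u) = 0.
Proof.
rewrite star_delta.
have -> : (i - k + h *+ u == i + k + h *+ v - k + h *+ (w (+) t)) = false.
  by rewrite (@twist_neq (- k) u v (w (+) t)) //; ring.
have -> : (i - k + h *+ u == i + k + h *+ v + h *+ t) = false.
  by rewrite (@twist_neq (- (k + k)) u v t) //; ring.
by rewrite addr0.
Qed.

Lemma star_down_up : star c k X (delta (t, i - k + h *+ v)) (w, i + h *+ u) = 0.
Proof.
rewrite star_delta.
have -> : (i + h *+ u == i - k + h *+ v - k + h *+ (w (+) t)) = false.
  by rewrite (@twist_neq (k + k) u v (w (+) t)) //; ring.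
have -> : (i + h *+ u == i - k + h *+ v + h *+ t) = false.
  by rewrite (@twist_neq k u v t) //; ring.
by rewrite addr0.
Qed.

Lemma star_down_down : star c k X (delta (t, i - k + h *+ v)) (w, i - k + h *+ u) =
  if u == v (+) t then c t (w (+) t) (i - k + h *+ v) * X (w (+) t, i + h *+ v)
  else 0.
Proof.
rewrite star_delta.
have -> : (i - k + h *+ u == i - k + h *+ v - k + h *+ (w (+) t)) = false.
  by rewrite (@twist_neq k u v (w (+) t)) //; ring.
rewrite twist_eqD; have -> : i - k + h *+ v + k = i + h *+ v by ring.
by rewrite add0r.
Qed.

End Coordinates.

Lemma star_subr X (a b : F) (U V : G -> F) g :
  star c k X (fun g => a * U g - b * V g) g = a * star c k X U g - b * star c k X V g.
Proof. by case: g => w i; rewrite !starE; ring. Qed.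

Variables (X : G -> F) (rkX : rank_le4 c k X) (s : bool) (i : Z).
Hypothesis Xsi : X (s, i) != 0.

Let V (a : bool * bool) : G -> F :=
  delta (a.2, if a.1 then i - k + h *+ false else i + k + h *+ false).
Let g (a : bool * bool) : G :=
  (s (+) a.2, if a.1 then i - k + h *+ a.2 else i + h *+ s).
Let D (a : bool * bool) : F :=
  (if a.1 then c a.2 s (i - k) else c s a.2 i) * X (s, i).

(** A non-zero coordinate of X at (s,i) yields four pivots in the products of X
with b(t,i+k) and b(t,i-k). *)
Lemma star_pivots a b : star c k X (V a) (g b) = if a == b then D a else 0.
Proof.
case: a b => [[] t] [[] u]; rewrite /V /g /D xpair_eqE
  ?star_up_up ?star_up_down ?star_down_up ?star_down_down //= mulr0n !addr0.
- by rewrite eq_sym; case: eqP => // ->; rewrite -addbA addbb addbF.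
- have -> : (s == s (+) u (+) t) = (t == u) by case: s t u => [] [] [].
  by case: eqP => // ->; rewrite -addbA addbb addbF.
Qed.

Lemma pivots_neq0 a : D a != 0.
Proof. by rewrite /D mulf_neq0 //; case: ifP. Qed.

(** When X has rank at most 4, the four pivots exhaust its rank: a product that
vanishes at the four pivot coordinates vanishes. *)
Lemma star_vanish U :
    (forall u, star c k X U (s (+) u, i - k + h *+ u) = 0) ->
    (forall w, star c k X U (w, i + h *+ s) = 0) ->
  star c k X U =1 fun=> 0.
Proof.
move=> U1 U2; apply: (rank_le4_vanish rkX star_pivots pivots_neq0) => -[[] u] /=.
  exact: U1.
exact: U2.
Qed.

Lemma star_delta_eq0 t j :
    star c k X (delta (t, j)) =1 (fun=> 0) -> forall s', X (s', j + k) = 0 /\ X (s', j - k) = 0.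
Proof.
move=> X0 s'; have E1 x : x = x - k + k + h *+ false by rewrite addr0 subrK.
have E2 x : x = x + k - k + h *+ false by rewrite addr0 addrK.
split; apply/eqP.
  have := star_down_down X (j + k) t t false (s' (+) t).
  rewrite -E2 X0 addFb eqxx addbK => /esym/eqP.
  by rewrite mulf_eq0 (negPf (c_neq0 _ _ _)) addr0.
have := star_up_up X (j - k) t s' false (s' (+) t).
rewrite -E1 X0 addFb addbK eqxx => /esym/eqP.
by rewrite mulf_eq0 (negPf (c_neq0 _ _ _)) addr0.
Qed.

(** The product with a basis vector far from i, i + k and i - k has no component
at the pivot positions. *)
Lemma far_delta_eq0 t j : (j - i) + (j - i) != 0 ->
    (j - i - k) + (j - i - k) != 0 -> (j - i + k) + (j - i + k) != 0 ->
  star c k X (delta (t, j)) =1 fun=> 0.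
Proof.
move=> j0 jk jNk.
have N x : x + x != 0 -> - x + - x != 0 by rewrite -opprD oppr_eq0.
apply: star_vanish => u; rewrite star_delta.
  rewrite (@twist_neq (- (j - i)) u false (s (+) u (+) t)) ?N //; last by rewrite mulr0n; ring.
  rewrite (@twist_neq (- (j - i + k)) u false t) ?N ?addr0 //; by rewrite mulr0n; ring.
rewrite (@twist_neq (- (j - i - k)) s false (u (+) t)) ?N //; last by rewrite mulr0n; ring.
rewrite (@twist_neq (- (j - i)) s false t) ?N ?addr0 //; by rewrite mulr0n; ring.
Qed.

(** At the position of i itself, one of the two twists still misses the four
pivot coordinates; this excludes neighbours of i from the support of X, even
when the positions i, i + k, i - k form a triangle (3k = 0). *)
Lemma twin_delta_eq0 t :
  star c k X (delta (t, i + h *+ (~~ s (+) t))) =1 fun=> 0.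
Proof.
apply: star_vanish => u; rewrite star_delta.
  set v := ~~ s (+) t; set w := s (+) u (+) t.
  have -> : (i - k + h *+ u == i + h *+ v - k + h *+ w) = false.
    rewrite [i + _ - k]addrAC twist_eqD /v /w.
    by case: (s) (t) (u) => [] [] [].
  by rewrite (@twist_neq (- k) u v t) ?addr0 //; ring.
set v := ~~ s (+) t.
rewrite (@twist_neq k s v (u (+) t)) //; last by ring.
have -> : (i + h *+ s == i + h *+ v + h *+ t) = false.
  rewrite twist_eqD /v; by case: (s) (t) => [] [].
by rewrite addr0.
Qed.

(** From a position j outside {i, i + h}, a step of k leads to a basis vector that
X annihilates: step towards i when j is a neighbour of i, and otherwise take one
of j - k, j + k that avoids i + k and i - k, up to twists. *)
Lemma rank_le4_support t j : (j - i) + (j - i) != 0 -> X (t, j) = 0.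
Proof.
move=> ji; have twin x : x + x = 0 -> exists v : bool, x = h *+ v.
  by case/ker_double=> ->; [exists false | exists true].
have twin_eq0 x : x - i + (x - i) = 0 -> X (t, x + k) = 0 /\ X (t, x - k) = 0.
  move=> /twin[v vE]; have -> : x = i + h *+ v by rewrite -vE addrC subrK.
  have -> : v = ~~ s (+) (~~ s (+) v) by rewrite addbA addbb.
  by apply: star_delta_eq0; apply: twin_delta_eq0.
have [e|jk] := eqVneq ((j - i - k) + (j - i - k)) 0.
  by have /twin_eq0[] : j - k - i + (j - k - i) = 0; [rewrite -[RHS]e; ring | rewrite subrK].
have [e|jNk] := eqVneq ((j - i + k) + (j - i + k)) 0.
  by have /twin_eq0[] : j + k - i + (j + k - i) = 0; [rewrite -[RHS]e; ring | rewrite addrK].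
have [e|j2k] := eqVneq ((j - i - k - k) + (j - i - k - k)) 0.
  have /star_delta_eq0/(_ t)[_] : star c k X (delta (t, j + k)) =1 fun=> 0.
    apply: far_delta_eq0.
    - by apply: contra jNk => /eqP e1; apply/eqP; rewrite -[RHS]e1; ring.
    - by apply: contra ji => /eqP e1; apply/eqP; rewrite -[RHS]e1; ring.
    - apply: contra k8_neq0 => /eqP e1; apply/eqP.
      have -> : k *+ 8 = (j + k - i + k + (j + k - i + k))
        - (j - i - k - k + (j - i - k - k)) by ring.
      by rewrite e1 e subrr.
  by rewrite addrK.
have /star_delta_eq0/(_ t)[+ _] : star c k X (delta (t, j - k)) =1 fun=> 0.
  apply: far_delta_eq0.
  - by apply: contra jk => /eqP e1; apply/eqP; rewrite -[RHS]e1; ring.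
  - by apply: contra j2k => /eqP e1; apply/eqP; rewrite -[RHS]e1; ring.
  - by apply: contra ji => /eqP e1; apply/eqP; rewrite -[RHS]e1; ring.
by rewrite subrK.
Qed.

(** The coefficients of two proportionality relations, forward (step k) and
backward (step -k), between the products P = X(s,i) X(s,i+h) of the two
letters s; see [rank_le4_twins]. *)
Definition twin_form (e : bool) i :=
  c e false i * c e true (i + h) * (c false (~~ e) (i - k) * c true (~~ e) (i - k + h)).
Hypothesis nondegenerate : forall i, twin_form false i != twin_form true i.

(** With only four pivots, the remaining products at the twisted positions are
multiples of the pivot ones.  This gives two linear equations between P and
P', whose determinant is the difference of the two twin forms. *)
Lemma rank_le4_twins :
  X (s, i + h) = 0 /\ X (~~ s, i) * X (~~ s, i + h) = 0.
Proof.
pose P := X (s, i) * X (s, i + h); pose P' := X (~~ s, i) * X (~~ s, i + h).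
have ih x : x + h *+ true = x + h by [].
have i0 x : x + h *+ false = x by rewrite addr0.
have up : P * (c s false i * c s true (i + h)) =
          P' * (c (~~ s) false i * c (~~ s) true (i + h)).
  (* the combination whose pivot coordinates cancel *)
  pose U l := c s false i * X (s, i) * delta (true, i + k + h *+ true) l
    - X (~~ s, i + h) * c (~~ s) true (i + h) * delta (false, i + k + h *+ false) l.
  have U_down u : star c k X U (s (+) u, i - k + h *+ u) = 0.
    by rewrite star_subr !star_up_down !mulr0 subrr.
  have U_up w : star c k X U (w, i + h *+ s) = 0.
    rewrite star_subr !star_up_up !ih !i0 !addbF addFb addTb addbT negbK eq_sym.
    by case: eqP => [->|_]; rewrite ?mulr0 ?subrr //; ring.
  have := star_vanish U_down U_up (~~ s, i + h *+ ~~ s).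
  rewrite star_subr !star_up_up !ih !i0 !addbF !addbT addFb addTb !negbK !eqxx => E.
  by apply/eqP; rewrite -subr_eq0 /P /P'; apply/eqP; rewrite -[RHS]E; ring.
have down : P * (c false s (i - k) * c true s (i - k + h)) =
            P' * (c false (~~ s) (i - k) * c true (~~ s) (i - k + h)).
  pose U l := c false s (i - k) * X (s, i) * delta (true, i - k + h *+ true) l
    - X (~~ s, i + h) * c true (~~ s) (i - k + h) * delta (false, i - k + h *+ false) l.
  have U_down u : star c k X U (s (+) u, i - k + h *+ u) = 0.
    rewrite star_subr !star_down_down !ih !i0 !addbF /=.
    by case: u; rewrite /= ?addbF ?addbT ?mulr0 ?subrr //; ring.
  have U_up w : star c k X U (w, i + h *+ s) = 0.
    by rewrite star_subr !star_down_up !mulr0 subrr.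
  have := star_vanish U_down U_up (~~ s, i - k + h *+ false).
  rewrite star_subr !star_down_down !ih !i0 !addbF !addbT /= negbK => E.
  by apply/eqP; rewrite -subr_eq0 /P /P'; apply/eqP; rewrite -[RHS]E; ring.
have P0 : P = 0.
  apply/eqP; have := nondegenerate i; apply: contraR => P0.
  have P'0 : P' != 0.
    apply: contra P0 => /eqP P'0; move/eqP: up.
    by rewrite P'0 mul0r !mulf_eq0 !(negPf (c_neq0 _ _ _)) !orbF.
  apply/eqP; apply: (mulfI (mulf_neq0 P0 P'0)); rewrite /twin_form.
  case: (s) up down => /= up down.
    transitivity (P' * (c false false i * c false true (i + h)) *
      (P * (c false true (i - k) * c true true (i - k + h)))); first by ring.
    by rewrite -up down; ring.
  transitivity (P * (c false false i * c false true (i + h)) *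
      (P' * (c false true (i - k) * c true true (i - k + h)))); first by ring.
  by rewrite up -down; ring.
move/eqP: (P0); rewrite mulf_eq0 (negPf Xsi) => /eqP Xsh; split=> //.
by move/esym/eqP: up; rewrite P0 mul0r !mulf_eq0 !(negPf (c_neq0 _ _ _)) /= !orbF -mulf_eq0 => /eqP.
Qed.

End Support.

Lemma star_expand c k X U : star c k X U =1
  fun l => \sum_j U j * star c k X (delta j) l.
Proof. by apply: star_combr => l; rewrite sum_delta. Qed.

Lemma sum_over_support (I J : finType) (f : J -> I) (x : I -> F) :
    injective f -> (forall i, (forall j, f j != i) -> x i = 0) ->
  \sum_i x i = \sum_j x (f j).
Proof.
move=> f_inj x0; transitivity (\sum_(i in f @: [set: J]) x i); last first.
  by rewrite big_imset => [|a b _ _]; [apply: eq_bigl => j; rewrite inE | apply: f_inj].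
symmetry; rewrite big_mkcond; apply: eq_bigr => i _; case: imsetP => // fi.
by rewrite x0 // => j; apply/eqP=> fj; case: fi; exists j.
Qed.

Section Planes.
Variables (c : bool -> bool -> Z -> F) (k : Z).
Hypothesis k2_neq0 : k + k != 0.

(** X is concentrated at one position, so X * U depends on four coordinates of
U only. *)
Lemma rank_le4_twin_plane X i :
  (forall s j, j != i -> X (s, j) = 0) -> rank_le4 c k X.
Proof.
move=> suppX.
pose col (a : bool * bool) : G := (a.2, if a.1 then i - k else i + k).
exists (fun a => star c k X (delta (col a))) => U.
exists (fun a => U (col a)) => l; rewrite star_expand.
apply: (sum_over_support (f := col)).
  move=> [d t] [d' t'] [->]; case: d d' => [] [] // /addrI/eqP.
    by rewrite eq_sym -subr_eq0 opprK (negPf k2_neq0).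
  by rewrite -subr_eq0 opprK (negPf k2_neq0).
move=> [t j] notcol; case: l => w l; rewrite star_delta !suppX.
- by rewrite !mulr0 !if_same addr0 mulr0.
- have := notcol (true, t); rewrite xpair_eqE eqxx /=.
  by apply: contra => /eqP<-; rewrite addrK.
- have := notcol (false, t); rewrite xpair_eqE eqxx /=.
  by apply: contra => /eqP<-; rewrite subrK.
Qed.

(** Here X * U may depend on eight coordinates of U, but it takes its values in
the span of four basis vectors. *)
Lemma rank_le4_cross_plane X i :
    (forall s j, (s, j) != (false, i) -> (s, j) != (true, i + h) -> X (s, j) = 0) ->
  rank_le4 c k X.
Proof.
move=> suppX.
pose row (a : bool * bool) : G := (a.2, if a.1 then i - k + h *+ a.2 else i).
exists (fun a => delta (row a)) => U.
exists (fun a => star c k X U (row a)) => l.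
rewrite -[LHS]sum_delta.
apply: (sum_over_support (f := row) (x := fun j => star c k X U j * delta j l)).
  move=> [d t] [d' t'] [->]; case: d d' => [] [] // /eqP.
    by rewrite (@twist_neq (-k) t' false false) ?mulr0n ?subr0 -?opprD ?oppr_eq0 //; ring.
  by rewrite (@twist_neq k t' false false) ?mulr0n ?subr0 ?addr0 //; rewrite -[in RHS]twistN; ring.
move=> [w l'] notrow; rewrite starE.
have r0 := notrow (false, w); have r1 := notrow (true, w).
have l0 : i != l' by move: r0; rewrite xpair_eqE eqxx.
have X1 : X (false, l') = 0 by rewrite suppX // xpair_eqE //= eq_sym.
have X2 : X (true, l' + h) = 0.
  by rewrite suppX // xpair_eqE //= (inj_eq (addIr h)) eq_sym.
have lk : i - k + h *+ w != l' by move: r1; rewrite xpair_eqE eqxx.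
have X3 : X (w, l' + k) = 0.
  move: lk; case: (w) => lk; rewrite suppX // xpair_eqE //=; apply: contra lk => /eqP E.
    have -> : i = l' + k + h *+ true by rewrite E; rewrite (twistK true).
    by rewrite addrAC (twistK true) addrK.
  by rewrite -E addrK addr0.
have X4 : X (~~ w, l' + h + k) = 0.
  move: lk; case: (w) => lk; rewrite suppX // xpair_eqE //=; apply: contra lk => /eqP E.
    by rewrite -E addrK (twistK true).
  by move: E; rewrite addrAC => /addIr <-; rewrite addrK addr0.
by rewrite X1 X2 X3 X4 !mul0r !addr0 !mulr0 addr0 mul0r.
Qed.

End Planes.

(** * Isotopisms of sparse multiplications permute the basis lines *)

Section Monomial.
Variables (c c' : bool -> bool -> Z -> F) (k k' : Z) (A B N : G -> G -> F).
Hypotheses (k2_neq0 : k + k != 0) (k'8_neq0 : k' *+ 8 != 0).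
Hypothesis c'_neq0 : forall s t i, c' s t i != 0.
Hypothesis nondeg : forall i, twin_form c' k' false i != twin_form c' k' true i.
Hypothesis isotopy : forall X U,
  apply_mx N (star c k X U) =1 star c' k' (apply_mx A X) (apply_mx B U).
Hypothesis A_inj : forall X, apply_mx A X =1 (fun=> 0) -> X =1 fun=> 0.
Hypothesis B_surj : forall U, exists U', apply_mx B U' =1 U.

Lemma rank_le4_isotopy X : rank_le4 c k X -> rank_le4 c' k' (apply_mx A X).
Proof.
move=> [z z_span]; exists (fun j => apply_mx N (z j)) => U.
have [U' BU'] := B_surj U; have [d dE] := z_span U'; exists d => l.
by rewrite -(apply_comb N dE) isotopy; apply: star_ext => // g; rewrite BU'.
Qed.

Lemma rank_le4_pair (x y : F) s i t (v : bool) : t = ~~ s ->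
  rank_le4 c k (fun g => x * delta (s, i) g + y * delta (t, i + h *+ v) g).
Proof.
move=> ->{t}.
have off (a : F) g g' : g != g' -> a * delta g' g = 0.
  by rewrite /delta => /negPf->; rewrite mulr0.
case: v; last first.
  apply: (rank_le4_twin_plane _ k2_neq0 (i := i)) => u j ji.
  by rewrite addr0 !off ?addr0 // xpair_eqE (negPf ji) andbF.
case: s => /=; last first.
  by apply: (rank_le4_cross_plane _ k2_neq0 (i := i)) => u j n1 n2; rewrite !off ?addr0.
apply: (rank_le4_cross_plane _ k2_neq0 (i := i + h)) => u j n1 n2; rewrite !off ?addr0 //.
by move: n2; rewrite -addrA h2 addr0.
Qed.

Lemma apply_delta2 (x y : F) a b : apply_mx A (fun g => x * delta a g + y * delta b g) =1
  fun g => x * A g a + y * A g b.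
Proof.
move=> g; rewrite /apply_mx.
under eq_bigr => j _ do rewrite mulrDr ![A g j * _]mulrCA.
rewrite big_split /= -!mulr_sumr.
have AE a' : \sum_j A g j * delta a' j = A g a' by rewrite -/(apply_mx A _ g) apply_delta.
by rewrite !AE.
Qed.

Lemma rank_le4_ext X Y : X =1 Y -> rank_le4 c' k' X -> rank_le4 c' k' Y.
Proof.
move=> XY [z z_span]; exists z => U; have [d dE] := z_span U; exists d => l.
by rewrite -dE; apply: star_ext => // g; rewrite XY.
Qed.

Lemma rank_le4_columns (x y : F) s i t (v : bool) : t = ~~ s ->
  rank_le4 c' k' (fun g => x * A g (s, i) + y * A g (t, i + h *+ v)).
Proof.
move=> ts; apply: rank_le4_ext (apply_delta2 _ _ _ _) _.
by apply: rank_le4_isotopy; apply: rank_le4_pair.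
Qed.

(** A vector of rank at most 4 has at most one non-zero coordinate for each
letter. *)
Lemma rank_le4_unique X s i j :
  rank_le4 c' k' X -> X (s, i) != 0 -> X (s, j) != 0 -> j = i.
Proof.
move=> rkX Xi Xj; have [e|n] := eqVneq (j - i + (j - i)) 0; last first.
  by case/eqP: Xj; apply: (rank_le4_support c'_neq0 k'8_neq0 rkX Xi).
have [/eqP|/eqP] := ker_double e; rewrite subr_eq ?add0r => /eqP // ji.
have [Xih _] := rank_le4_twins c'_neq0 k'8_neq0 rkX Xi nondeg.
by case/eqP: Xj; rewrite ji addrC.
Qed.

(** A coordinate of Y outside the plane of X would give X + Y two non-zero
coordinates for the same letter. *)
Lemma column_in_plane X Y s i j :
    rank_le4 c' k' X -> rank_le4 c' k' Y -> rank_le4 c' k' (fun g => X g + Y g) ->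
    X (s, i) != 0 -> X (~~ s, j) != 0 ->
  forall g, g != (s, i) -> g != (~~ s, j) -> Y g = 0.
Proof.
move=> rkX rkY rkXY Xi Xj.
have key t l l' : X (t, l) != 0 -> l' != l -> Y (t, l') = 0.
  move=> Xl l'l; apply/eqP; apply: contraNT l'l => Yl'; apply/eqP.
  have [X0|/(rank_le4_unique rkX Xl) //] := eqVneq (X (t, l')) 0.
  have [Y0|/(rank_le4_unique rkY Yl') //] := eqVneq (Y (t, l)) 0.
  by apply: (rank_le4_unique rkXY (s := t)); rewrite ?X0 ?Y0 ?addr0 ?add0r.
move=> [t l]; rewrite !xpair_eqE; have [->|ts] /= := eqVneq t s.
  by move=> li _; apply: key Xi li.
have -> : t = ~~ s by case: t s ts {Xi Xj key} => [] [].
by rewrite eqxx /= => _; apply: key.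
Qed.

(** Otherwise the image of b(s,i) has two non-zero coordinates, and the images of
the two planes of vectors of rank at most 4 through b(s,i) both lie in the same
coordinate plane.  The images of three independent vectors would then be
dependent. *)
Lemma column_monomial g : exists g', forall l, l != g' -> A l g = 0.
Proof.
case: g => s i.
have [[t j] /= x_neq0|A0] := pickP (fun l => A l (s, i) != 0); last first.
  by exists (s, i) => l _; apply/eqP/negPn; rewrite A0.
exists (t, j) => -[t' j'] neq; apply/eqP/negPn/negP=> y_neq0.
pose g1 (v : bool) : G := (~~ s, i + h *+ v).
have rkX : rank_le4 c' k' (fun g => A g (s, i)).
  apply: (rank_le4_ext _ (rank_le4_columns 1 0 i false (erefl (~~ s)))) => l.
  by rewrite mul1r mul0r addr0.
have rkY v : rank_le4 c' k' (fun g => A g (g1 v)).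
  apply: (rank_le4_ext _ (rank_le4_columns 0 1 i v (erefl (~~ s)))) => l.
  by rewrite mul1r mul0r add0r.
have rkXY v : rank_le4 c' k' (fun g => A g (s, i) + A g (g1 v)).
  by apply: (rank_le4_ext _ (rank_le4_columns 1 1 i v (erefl (~~ s)))) => l; rewrite !mul1r.
have tE : t' = ~~ t.
  have [tE|] := eqVneq t' t; last by case: (t) (t') => [] [].
  by case/eqP: neq; rewrite tE; congr (_, _); apply: rank_le4_unique rkX x_neq0 _; rewrite -tE.
move: {neq} y_neq0; rewrite {}tE => y_neq0.
have Y0 v := column_in_plane rkX (rkY v) (rkXY v) x_neq0 y_neq0.
have X0 l : l != (t, j) -> l != (~~ t, j') -> A l (s, i) = 0.
  case: l => u l; rewrite !xpair_eqE => n1 n2; apply/eqP/negPn/negP => n0.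
  have [ut|/eqP ut] := eqVneq u t.
    rewrite ut in n0 n1; rewrite (rank_le4_unique rkX x_neq0 n0) eqxx in n1.
    by rewrite eqxx in n1.
  have uE : u = ~~ t by case: (u) (t) ut => [] [].
  by rewrite uE in n0 n2; rewrite (rank_le4_unique rkX y_neq0 n0) !eqxx in n2.
set x := A (t, j) (s, i) in x_neq0 *; set y := A (~~ t, j') (s, i) in y_neq0.
pose x_ v := A (t, j) (g1 v); pose y_ v := A (~~ t, j') (g1 v).
(* A is injective and the three columns vanish outside one plane *)
have comb a b d : a * x + b * x_ false + d * x_ true = 0 ->
    a * y + b * y_ false + d * y_ true = 0 -> [/\ a = 0, b = 0 & d = 0].
  move=> ex ey; pose U g := a * delta (s, i) g + b * delta (g1 false) g + d * delta (g1 true) g.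
  have AU l : apply_mx A U l = a * A l (s, i) + b * A l (g1 false) + d * A l (g1 true).
    rewrite /apply_mx /U.
    under eq_bigr => j0 _ do rewrite !mulrDr ![A l j0 * _]mulrCA.
    by rewrite !big_split /= -!mulr_sumr -!/(apply_mx A _ l) !apply_delta.
  have U0 : U =1 fun=> 0.
    apply: A_inj => l; rewrite AU.
    have [->|n1] := eqVneq l (t, j); first exact: ex.
    have [->|n2] := eqVneq l (~~ t, j'); first exact: ey.
    by rewrite X0 // !Y0 // !mulr0 !addr0.
  have ns (v : bool) : ((~~ s, i + h *+ v) == (s, i)) = false by rewrite xpair_eqE; case: (s).
  have ns' (v : bool) : ((s, i) == (~~ s, i + h *+ v)) = false by rewrite eq_sym ns.
  have nh (v : bool) : ((~~ s, i + h *+ v) == (~~ s, i + h *+ ~~ v)) = false.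
    by rewrite xpair_eqE eqxx (inj_eq (addrI _)) twist_inj; case: v.
  have := (U0 (s, i), U0 (g1 false), U0 (g1 true)); rewrite /U /delta /g1.
  rewrite !eqxx !ns !ns' (nh false) (nh true) !mulr0 !mulr1 !addr0 !add0r.
  by case=> [[]].
(* the vector product is orthogonal to both rows of coordinates *)
have [_ _ /eqP] : [/\ x_ false * y_ true - x_ true * y_ false = 0,
    x_ true * y - x * y_ true = 0 & x * y_ false - x_ false * y = 0].
  by apply: comb; ring.
rewrite subr_eq0 => /eqP xy.
have [_ /eqP] : [/\ - x_ false = 0, x = 0 & 0 = 0 :> F].
  apply: comb; first by ring.
  by rewrite mul0r addr0 xy; ring.
by rewrite (negPf x_neq0).
Qed.

End Monomial.

Lemma star_delta_delta c k s t i : k + k != 0 ->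
  star c k (delta (s, i)) (delta (t, i + k)) =1
  fun g => c s t i * delta (s (+) t, i + h *+ s) g.
Proof.
move=> k2 [w l]; rewrite star_delta /delta !xpair_eqE addrK eqxx andbT.
have -> : (i + k + k == i) = false.
  by rewrite -[X in _ == X]addr0 -addrA (inj_eq (addrI i)) (negPf k2).
rewrite andbF mulr0 if_same addr0.
have -> : (w == s (+) t) = (w (+) t == s) by case: s t w => [] [] [].
have [->|_] := eqVneq (w (+) t) s; last by rewrite !mulr0 if_same.
by case: eqP => _; rewrite ?mulr0.
Qed.

Lemma star_delta_neq0 c k s t i j :
  ~ star c k (delta (s, i)) (delta (t, j)) =1 (fun=> 0) -> j = i + k \/ i = j + k.
Proof.
move=> n0; have [e|n1] := eqVneq (j - k) i; first by left; rewrite -e subrK.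
have [e|n2] := eqVneq (j + k) i; first by right.
case: n0 => -[w l]; rewrite star_delta /delta !xpair_eqE (negPf n1) (negPf n2).
by rewrite !andbF !mulr0 !if_same addr0.
Qed.

End TwinStar.

(** * Arithmetic of admissible exponents *)

Lemma dvdn_mul_order m k : (m %| k * (m %/ gcdn k m))%N.
Proof.
rewrite muln_divA ?dvdn_gcdr // mulnC -muln_divA ?dvdn_gcdl //.
exact: dvdn_mulr.
Qed.

Lemma admissible_dual m k : admissible m k -> admissible m (m - k).
Proof.
move=> [k1 k2 kodd]; have km : (k <= m)%N by lia.
split; [lia | lia |]; suff -> : gcdn (m - k) m = gcdn k m by [].
have mE : m = (m - k + k)%N by rewrite subnK.
by move: (m - k)%N mE => n ->; rewrite gcdnDl gcdnDr gcdnC.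
Qed.

(** * Squares and Frobenius powers in the finite field *)

Section FiniteField.
Variables (p m : nat) (p_prime : prime p) (p_odd : odd p) (m_gt0 : (0 < m)%N).
Variables (M : fieldExtType 'F_p) (dimM : \dim {: M} = m).
Implicit Types (x y z : M).

Lemma pchar_field : p \in [pchar M].
Proof. by rewrite pchar_lalg pchar_Fp. Qed.

Lemma frobD n x y : (x + y) ^+ (p ^ n) = x ^+ (p ^ n) + y ^+ (p ^ n).
Proof.
by rewrite exprDn_pchar // pnatX (pnatE _ p_prime) pchar_field.
Qed.

Lemma frob_inj n : injective (fun x => x ^+ (p ^ n)).
Proof.
have N (u v : M) : (u - v) ^+ (p ^ n) = u ^+ (p ^ n) - v ^+ (p ^ n).
  by have := frobD n (u - v) v; rewrite subrK => ->; rewrite addrK.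
move=> x y /eqP; rewrite -subr_eq0 -N expf_eq0 subr_eq0 => /andP[_ /eqP//].
Qed.

Lemma frobN n x : (- x) ^+ (p ^ n) = - x ^+ (p ^ n).
Proof. by rewrite exprNn -signr_odd oddX p_odd orbT mulN1r. Qed.

Lemma mem_subfield (K : {subfield M}) x : (x \in K) = (x ^+ (p ^ \dim K) == x).
Proof. by rewrite Fermat's_little_theorem card_Fp. Qed.

Lemma frob_card x : x ^+ (p ^ m) = x.
Proof. by apply/eqP; rewrite -dimM -mem_subfield memvf. Qed.

Lemma frob_modn n x : x ^+ (p ^ (n %% m)) = x ^+ (p ^ n).
Proof.
rewrite [in RHS](divn_eq n m) expnD exprM; congr (_ ^+ _).
by elim: (n %/ m)%N => [|q IHq]; rewrite ?expr1 // mulSn expnD exprM frob_card.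
Qed.

Lemma card_field : #|finvect_type M| = (p ^ m)%N.
Proof.
transitivity #|(fullv : {vspace finvect_type M})|.
  by apply: eq_card => x; rewrite (memvf (x : finvect_type M)) inE.
by rewrite card_vspace card_Fp // -[in RHS]dimM.
Qed.

Lemma primitive_root_exists : exists g : M, (p ^ m - 1).-primitive_root g.
Proof.
have n_gt0 : (0 < p ^ m - 1)%N by rewrite subn_gt0 -(exp1n m) ltn_exp2r ?prime_gt1.
pose rs := [seq x <- enum (finvect_type M) | x != 0].
have /hasP[g _ prim_g] : has (p ^ m - 1).-primitive_root (rs : seq M).
  apply: has_prim_root n_gt0 _ _ _.
  - apply/allP=> x; rewrite mem_filter => /andP[x0 _].
    rewrite unity_rootE; apply/eqP/(mulfI x0); rewrite mulr1 -exprS subn1 prednK.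
      exact: frob_card.
    by rewrite expn_gt0 prime_gt0.
  - exact: filter_uniq (enum_uniq (mem (finvect_type M))).
  - rewrite -card_field subn1 -(cardC1 (0 : finvect_type M)) cardE /rs.
    apply: uniq_leq_size => [|x]; first exact: enum_uniq.
    rewrite mem_enum inE mem_filter => -> /=.
    by have := mem_enum (finvect_type M) (x : finvect_type M); rewrite inE.
by exists g.
Qed.

Lemma primitive_neq0 (g : M) : (p ^ m - 1).-primitive_root g -> g != 0.
Proof.
move=> prim_g; apply/eqP=> g0; have := prim_expr_order prim_g.
rewrite g0 expr0n subn_eq0 leqNgt -[X in (X < _)%N](exp1n m) ltn_exp2r ?prime_gt1 //=.
by move/eqP; rewrite eq_sym oner_eq0.
Qed.

Lemma nonzero_is_power g x : (p ^ m - 1).-primitive_root g -> x != 0 -> exists i, x = g ^+ i.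
Proof.
move=> prim_g x0; have [] // := prim_rootP prim_g (x := x).
  apply: (mulfI x0); rewrite mulr1 -exprS subn1 prednK ?frob_card //.
  by rewrite expn_gt0 prime_gt0.
by move=> i ->; exists i.
Qed.

Lemma nonsquareM (B B' : M) : nonsquare B -> nonsquare B' -> exists2 z, z != 0 & B' = B * z ^+ 2.
Proof.
have [g prim_g] := primitive_root_exists.
move=> [B0 nsB] [B'0 nsB'].
have [i iE] := nonzero_is_power prim_g B0; have [j jE] := nonzero_is_power prim_g B'0.
have odd_exp l : ~ (exists z, g ^+ l = z ^+ 2) -> odd l.
  move=> ns; apply/negPn/negP => /even_halfK l2; case: ns.
  by exists (g ^+ l./2); rewrite -exprM muln2 l2.
have oi : odd i by apply: odd_exp; rewrite -iE.
have oj : odd j by apply: odd_exp; rewrite -jE.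
have ij : (i + j = (i + j)./2 * 2)%N by rewrite muln2 even_halfK // oddD oi oj.
exists (g ^+ (i + j)./2 / B).
  by rewrite mulf_neq0 ?invr_eq0 // expf_neq0 // primitive_neq0.
by rewrite expr_div_n -exprM -ij exprD -iE -jE; field.
Qed.

Variable (m_even : ~~ odd m).
Let Q := (p ^ m./2)%N.

Lemma card_half : (p ^ m = Q * Q)%N.
Proof. by rewrite -expnD addnn even_halfK. Qed.

Lemma frobQK x : (x ^+ Q) ^+ Q = x.
Proof. by rewrite -exprM -card_half frob_card. Qed.

(** Elements fixed by the Q-power map are (Q+1)-th powers, and Q + 1 is even. *)
Lemma conj_fixed_square x : x != 0 -> x ^+ Q = x -> exists2 z, z != 0 & x = z ^+ 2.
Proof.
move=> x0 xQ; have [g prim_g] := primitive_root_exists.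
have [i iE] := nonzero_is_power prim_g x0.
have Q_gt1 : (1 < Q)%N.
  rewrite -(exp1n m./2) ltn_exp2r ?prime_gt1 // half_gt0.
  by case: (m) m_gt0 m_even => [|[]].
have : (p ^ m - 1 %| i * (Q - 1))%N.
  rewrite (prim_order_dvd prim_g) exprM -iE; apply/eqP/(mulfI x0).
  by rewrite mulr1 -exprS subn1 prednK ?xQ // ltnW.
have -> : (p ^ m - 1 = (Q + 1) * (Q - 1))%N by rewrite card_half; nia.
rewrite dvdn_pmul2r ?subn_gt0 // => /dvdnP[j iE2].
have Q1 : (Q + 1 = (Q + 1)./2 * 2)%N.
  by rewrite muln2 even_halfK // oddD oddX p_odd orbT.
exists (g ^+ (j * (Q + 1)./2)); first by rewrite expf_neq0 // primitive_neq0.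
by rewrite -exprM -mulnA -Q1 -iE2.
Qed.

Lemma norm_square x : x != 0 -> exists2 z, z != 0 & x * x ^+ Q = z ^+ 2.
Proof.
move=> x0; apply: conj_fixed_square; first by rewrite mulf_neq0 // expf_neq0.
by rewrite exprMn frobQK mulrC.
Qed.

(** Hilbert 90 for the involution x |-> x ^ Q. *)
Lemma hilbert90 (t : M) : t * t ^+ Q = 1 -> t != -1 -> exists2 d, d != 0 & t = d ^+ Q / d.
Proof.
move=> tt t1; have t0 : t != 0.
  by apply/eqP=> t0; move/eqP: tt; rewrite t0 mul0r eq_sym oner_eq0.
have d0 : 1 + t != 0 by rewrite addrC addr_eq0.
exists (1 + t)^-1; first by rewrite invr_eq0.
have tQ : t ^+ Q = t^-1 by apply: (mulfI t0); rewrite tt divff.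
rewrite exprVn frobD expr1n tQ; field.
by rewrite t0 d0 oner_neq0.
Qed.

Variable k : nat.
Hypothesis adm_k : admissible m k.
Let q := (p ^ k)%N.
Let l := (m %/ gcdn k m)%N.

Lemma odd_l : odd l. Proof. by case: adm_k. Qed.

Lemma frob_order x : x ^+ (q ^ l) = x.
Proof.
rewrite /q -expnM; have /dvdnP[j ->] := dvdn_mul_order m k.
by rewrite -frob_modn modnMl expr1.
Qed.

(** The q-power map has odd order, so it cannot act on x as a non-trivial
involution. *)
Lemma odd_order_involution x (f : M -> M) : x ^+ q = f x -> (forall y, f (f y) = y) ->
   (f x) ^+ q = f (x ^+ q) -> f x = x.
Proof.
move=> xq ff fq; rewrite -[RHS]frob_order.
have E n : x ^+ (q ^ n) = if odd n then f x else x.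
  elim: n => [|n IHn]; first by rewrite expr1.
  by rewrite expnS mulnC exprM IHn /=; case: (odd n) => //=; rewrite fq xq ff.
by rewrite E odd_l.
Qed.

Lemma expq1_kernel x : x ^+ (q + 1) = 1 -> x = 1 \/ x = -1.
Proof.
rewrite addn1 exprS => xq; have x0 : x != 0.
  by apply/eqP=> x0; move/eqP: xq; rewrite x0 mul0r eq_sym oner_eq0.
have xqE : x ^+ q = x^-1 by apply: (mulfI x0); rewrite xq divff.
have : x^-1 = x by apply: odd_order_involution => // [y|]; rewrite ?invrK // exprVn.
move=> e; have : x ^+ 2 == 1 by rewrite expr2 -{1}e mulVf.
by rewrite sqrf_eq1 => /orP[] /eqP; [left | right].
Qed.

Lemma expq1_inj x y : x ^+ (q + 1) = y ^+ (q + 1) -> x = y \/ x = - y.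
Proof.
have [->|y0] := eqVneq y 0.
  by rewrite [in RHS]addn1 expr0n /= => /eqP; rewrite expf_eq0 => /andP[_ /eqP->]; left.
move=> e; have /expq1_kernel[xy|xy] : (x / y) ^+ (q + 1) = 1.
- by rewrite expr_div_n e divff // expf_neq0.
- by left; rewrite -[x](divfK y0) xy mul1r.
- by right; rewrite -[x](divfK y0) xy mulN1r.
Qed.

(** Since the q-power map sigma has odd order l, one has
(sigma + 1)(1 - sigma + sigma^2 - ... + sigma^(l-1)) = 2; the root t below is the
alternating product of conjugates given by the second factor. *)
Lemma expq1_surj z : z != 0 -> exists2 t, t != 0 & t ^+ (q + 1) = z ^+ 2.
Proof.
move=> z0.
have E n : exists2 t, t != 0 & t ^+ (q + 1) = if odd n then z * z ^+ (q ^ n) else z / z ^+ (q ^ n).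
  elim: n => [|n [t t0 tE]]; first by exists 1; rewrite ?oner_neq0 // expr1n expr1 divff.
  exists (if odd n then t / z ^+ (q ^ n) else t * z ^+ (q ^ n)).
    by case: ifP => _; rewrite mulf_neq0 ?invr_eq0 ?expf_neq0.
  have e : z ^+ (q ^ n) ^+ (q + 1) = z ^+ (q ^ n) * z ^+ (q ^ n.+1).
    by rewrite addn1 exprS -exprM -expnSr.
  rewrite /=; case: (odd n) tE => /= tE; rewrite ?expr_div_n ?exprMn tE e; field.
    by rewrite !expf_neq0.
  by rewrite expf_neq0.
by have [t t0] := E l; rewrite odd_l frob_order -expr2 => tE; exists t.
Qed.

(** * Scaling equivalence of parameters *)

(** The condition for (x, y) |-> (t x, y) to be a strong isotopism between the
members with parameters (B, a) and (B', a').  The second parameter is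
al = a / B, because exchanging x and y inverts both B and a / B. *)
Definition rescaling (B al B' al' : M) :=
  exists2 t : M, t != 0 & t ^+ (q + 1) * B = B' /\ t ^+ (q * Q) * al = t * al'.

Lemma rescaling_trans B al B' al' B'' al'' : rescaling B al B' al' ->
  rescaling B' al' B'' al'' -> rescaling B al B'' al''.
Proof.
move=> [t t0 [tB tal]] [u u0 [uB ual]]; exists (u * t); first by rewrite mulf_neq0.
by rewrite !exprMn -!mulrA tB uB tal [_ * (t * _)]mulrCA ual; split=> //; ring.
Qed.

Lemma frob_square n x : (exists z, x ^+ (p ^ n) = z ^+ 2) -> exists z, x = z ^+ 2.
Proof.
have [->|x0] := eqVneq x 0; first by exists 0; rewrite expr0n.
move=> [z zE]; have [j jE] : exists j, (p ^ n = j.*2.+1)%N.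
  by exists (p ^ n)./2; rewrite -[LHS]odd_double_half oddX p_odd orbT.
exists (z / x ^+ j); rewrite expr_div_n -zE jE exprS -mul2n mulnC exprM.
by rewrite mulfK // !expf_neq0.
Qed.

Lemma nonsquare_frob n (B : M) : nonsquare B -> nonsquare (B ^+ (p ^ n)).
Proof.
by move=> [B0 nsB]; split; [rewrite expf_neq0 | move/frob_square].
Qed.

Lemma norm_one_square (v : M) : v * v ^+ Q = 1 -> exists z, v = z ^+ 2.
Proof.
move=> vv; have [->|v1] := eqVneq v (-1).
  have [||z _ ->] := @conj_fixed_square (- 1); last by exists z.
    by rewrite oppr_eq0 oner_eq0.
  by rewrite /Q frobN expr1n.
have [d d0 ->] := hilbert90 vv v1; have [z z0 zE] := norm_square d0.
by exists (z / d); rewrite expr_div_n -zE; field.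
Qed.

(** Otherwise c = a ^ ((q+1)/2) would be an element fixed by the Q-power map with
the same norm as B ^ q; then c / B ^ q has norm one and is a square, as is c,
which makes B a square. *)
Lemma norm_not_twisted_square (B a : M) : nonsquare B -> a != 0 -> a ^+ Q = a ->
  a * a ^+ q <> (B * B ^+ Q) ^+ q.
Proof.
move=> [B0 nsB] a0 aQ e; apply: nsB; apply: (@frob_square k); rewrite -/q.
set B1 := B ^+ q; have B10 : B1 != 0 by rewrite expf_neq0.
pose j := (q + 1)./2; have jE : (q + 1 = j * 2)%N.
  by rewrite /j muln2 even_halfK // oddD oddX p_odd orbT.
pose c := a ^+ j; have c0 : c != 0 by rewrite expf_neq0.
have c2 : c ^+ 2 = B1 * B1 ^+ Q.
  by rewrite -exprM -jE addn1 exprS e exprMn -!exprM [(Q * q)%N]mulnC.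
have cQ : c ^+ Q = c by rewrite -exprM mulnC exprM aQ.
have [|z zE] := @norm_one_square (c / B1).
  rewrite expr_div_n cQ mulrACA -expr2 c2 -invfM divff //.
  by rewrite mulf_neq0 ?expf_neq0.
have [y y0 yE] := conj_fixed_square c0 cQ.
have z0 : z != 0.
  by apply: contraTneq (mulf_neq0 c0 (invr_neq0 B10)) => z0; rewrite zE z0 expr0n eqxx.
exists (y / z); rewrite expr_div_n -zE -yE; field.
by rewrite c0 B10.
Qed.

(** Choose t with t ^ (q+1) = B ^ Q / B.  Its norm to L is 1 or -1.  It cannot be
1, for then t = d ^ Q / d by Hilbert 90, B / d ^ (q+1) is fixed by the Q-power
map, and B is a square.  So the norm is -1, which is the sign in the statement. *)
Lemma rescaling_conj (B a : M) : nonsquare B -> a ^+ Q = a ->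
  rescaling B (a / B) (B ^+ Q) (- (a / B) ^+ Q).
Proof.
move=> [B0 nsB] aQ; have Q_odd : (Q = Q./2 * 2 + 1)%N.
  by rewrite -[LHS]odd_double_half oddX p_odd orbT muln2 addnC.
have [|t t0 tE] := @expq1_surj (B ^+ Q./2); first by rewrite expf_neq0.
have tB : t ^+ (q + 1) * B = B ^+ Q by rewrite tE -exprM [in RHS]Q_odd exprD expr1.
have BQ0 : B ^+ Q != 0 by rewrite expf_neq0.
have tQ0 : t ^+ Q != 0 by rewrite expf_neq0.
have tQB : (t ^+ Q) ^+ (q + 1) * B ^+ Q = B.
  by rewrite -exprM mulnC exprM -exprMn tB frobQK.
have /expq1_kernel[nt|nt] : (t * t ^+ Q) ^+ (q + 1) = 1.
- rewrite exprMn; apply: (mulIf (mulf_neq0 BQ0 B0)).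
  transitivity ((t ^+ (q + 1) * B) * ((t ^+ Q) ^+ (q + 1) * B ^+ Q)); first by ring.
  by rewrite tB tQB mul1r.
- case: nsB; have [t1|t1] := eqVneq t (-1).
    have BQ : B ^+ Q = B.
      by rewrite -tB t1 -signr_odd oddD oddX p_odd orbT expr0 mul1r.
    by have [z _ ->] := conj_fixed_square B0 BQ; exists z.
  have [d d0 tdE] := hilbert90 nt t1.
  have dq0 : d ^+ (q + 1) != 0 by rewrite expf_neq0.
  have [||z _ zE] := @conj_fixed_square (B / d ^+ (q + 1)).
  + by rewrite mulf_neq0 ?invr_eq0.
  + rewrite expr_div_n -tB tdE expr_div_n -!exprM [(Q * _)%N]mulnC; field.
    by rewrite dq0 expf_neq0.
  pose j := (q + 1)./2; have jE : (q + 1 = j * 2)%N.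
    by rewrite /j muln2 even_halfK // oddD oddX p_odd orbT.
  exists (z * d ^+ j); rewrite exprMn -zE -exprM -jE; field.
  exact: dq0.
exists t => //; split=> //.
have tr : t ^+ (q * Q) * t ^+ Q * B ^+ Q = B.
  by rewrite -[RHS]tQB addn1 exprSr -exprM [(Q * q)%N]mulnC.
apply: (mulIf tQ0); apply: (mulIf BQ0).
rewrite expr_div_n aQ.
transitivity (t ^+ (q * Q) * t ^+ Q * B ^+ Q * (a / B)); first by ring.
rewrite tr; transitivity (- (t * t ^+ Q) * a); last by field.
by rewrite nt; field.
Qed.

(** As e / e ^ Q = e ^ 2 / (e e ^ Q) and the norm e e ^ Q is a square in M, so is
e / e ^ Q; its root s is fixed by the q-power map, which has odd order, and the
norm of s squares to 1. *)
Lemma conj_ratio_sqrt (e : M) : e != 0 -> e ^+ q = e ->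
  exists s, [/\ s != 0, s ^+ 2 * e ^+ Q = e, s ^+ q = s & s * s ^+ Q = 1 \/ s * s ^+ Q = -1].
Proof.
move=> e0 eq; have [z z0 zE] := norm_square e0.
have eQ0 : e ^+ Q != 0 by rewrite expf_neq0.
have s2 : (e / z) ^+ 2 * e ^+ Q = e by rewrite expr_div_n -zE; field; rewrite e0 eQ0.
have s0 : e / z != 0 by rewrite mulf_neq0 ?invr_eq0.
move: (e / z) s0 s2 => s s0 s2; exists s; split=> //.
  have : (s ^+ q) ^+ 2 == s ^+ 2.
    apply/eqP/(mulIf eQ0); transitivity ((s ^+ 2 * e ^+ Q) ^+ q); last by rewrite s2 eq.
    by rewrite exprMn -!exprM [(2 * q)%N]mulnC [(Q * q)%N]mulnC [e ^+ (q * Q)]exprM eq.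
  rewrite eqf_sqr => /orP[/eqP//|/eqP sN].
  have := @odd_order_involution s -%R sN (@opprK _); rewrite frobN => /(_ erefl) sN'.
  by rewrite sN sN'.
have : (s * s ^+ Q) ^+ 2 == 1.
  apply/eqP/(mulfI e0); apply: (mulfI eQ0); rewrite mulr1.
  transitivity ((s ^+ 2 * e ^+ Q) * (s ^+ 2 * e ^+ Q) ^+ Q); last by rewrite s2 mulrC.
  by rewrite [(s ^+ 2 * _) ^+ Q]exprMn frobQK [s ^+ 2 ^+ Q]exprAC; ring.
by rewrite sqrf_eq1 => /orP[] /eqP; [left | right].
Qed.

(** The pair (t, e) is what an isotopism provides, e measuring how far it is from
being strong.  Replacing t by t s, with s ^ 2 = e / e ^ Q, removes e at the cost
of the norm of s, a sign. *)
Lemma rescaling_up_to_sign (B al B' al' t e : M) : t != 0 -> e != 0 -> e ^+ q = e ->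
    t ^+ (q + 1) * B * e = B' * e ^+ Q ->
    t ^+ (q * Q) * al * e ^+ Q = t * al' * e ->
  rescaling B al B' al' \/ rescaling B al B' (- al').
Proof.
move=> t0 e0 eq tB tal; have [s [s0 s2 sq ns]] := conj_ratio_sqrt e0 eq.
have eQ0 : e ^+ Q != 0 by rewrite expf_neq0.
have tsB : (t * s) ^+ (q + 1) * B = B'.
  apply: (mulIf eQ0); rewrite -tB exprMn addn1 [s ^+ q.+1]exprS sq -[in RHS]s2; ring.
have tsal : (t * s) ^+ (q * Q) * al = (s * s ^+ Q) * (t * s * al').
  apply: (mulIf eQ0); rewrite exprMn [s ^+ (q * Q)]exprM sq.
  transitivity (t * al' * (s ^+ 2 * e ^+ Q) * s ^+ Q); last by ring.
  by rewrite s2 -tal; ring.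
by case: ns tsal => -> tsal; [left | right]; exists (t * s); rewrite ?mulf_neq0 //;
  split=> //; rewrite tsal; ring.
Qed.

(** * Explicit strong isotopisms *)

Notation V := (M * M)%type.

(** Over a prime field additivity suffices for linearity. *)
Lemma linear_bijection (f : V -> V) :
    (forall u v, f (u + v) = f u + f v) -> injective f ->
  exists2 g : {linear V -> V}, g =1 f & bijective g.
Proof.
move=> fD f_inj.
have fMn u n : f (u *+ n) = f u *+ n.
  elim: n => [|n IHn]; last by rewrite !mulrS fD IHn.
  by apply: (addrI (f 0)); rewrite -fD !addr0.
have f_lin : linear f.
  move=> a u v; rewrite fD; congr (_ + _).
  by rewrite -[a](natr_Zp a) !scaler_nat fMn.
pose g : {linear V -> V} := HB.pack f (GRing.isLinear.Build _ _ _ _ f f_lin).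
by exists g => //; exact: (@injF_bij (finvect_type V) f f_inj).
Qed.

Lemma strongly_isotopicI mul1 mul2 (N L : V -> V) :
    (forall u v, N (u + v) = N u + N v) -> (forall u v, L (u + v) = L u + L v) ->
    injective N -> injective L ->
    (forall X U, N (mul1 X U) = mul2 (L X) (L U)) ->
  strongly_isotopic (V := V) mul1 mul2.
Proof.
move=> /linear_bijection Nl /linear_bijection Ll /Nl[N' N'E Nb] /Ll[L' L'E Lb] NL.
by exists N', L'; split=> // X U; rewrite N'E !L'E.
Qed.

Lemma strongly_isotopic_sym mul1 mul2 :
  strongly_isotopic (V := V) mul1 mul2 -> strongly_isotopic (V := V) mul2 mul1.
Proof.
move=> [N [L [[N' NK N'K] [L' LK L'K] NL]]].
have add (f : {linear V -> V}) g : cancel f g -> cancel g f -> forall u v, g (u + v) = g u + g v.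
  by move=> fK gK u v; apply: (can_inj fK); rewrite gK raddfD /= !gK.
apply: (strongly_isotopicI (N := N') (L := L')); try exact: add; try exact: can_inj.
by move=> X U; apply: (can_inj NK); rewrite N'K NL !L'K.
Qed.

Lemma strongly_isotopic_trans mul1 mul2 mul3 :
  strongly_isotopic (V := V) mul1 mul2 -> strongly_isotopic (V := V) mul2 mul3 ->
  strongly_isotopic (V := V) mul1 mul3.
Proof.
move=> [N [L [/bij_inj Ni /bij_inj Li NL]]] [N' [L' [/bij_inj N'i /bij_inj L'i NL']]].
apply: (strongly_isotopicI (N := N' \o N) (L := L' \o L)).
- by move=> u v /=; rewrite !raddfD.
- by move=> u v /=; rewrite !raddfD.
- exact: inj_comp.
- exact: inj_comp.
by move=> X U /=; rewrite NL NL'.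
Qed.

Lemma strongly_isotopic_isotopic mul1 mul2 :
  strongly_isotopic (V := V) mul1 mul2 -> isotopic (V := V) mul1 mul2.
Proof. by move=> [N [L [Nb Lb NL]]]; exists N, L, L. Qed.

Lemma isotopic_trans_strong mul1 mul2 mul3 :
  isotopic (V := V) mul1 mul2 -> strongly_isotopic (V := V) mul2 mul3 ->
  isotopic (V := V) mul1 mul3.
Proof.
move=> [N [L [L2 [Nb Lb L2b NL]]]] [N' [L' [N'b L'b NL']]].
exists (N' \o N), (L' \o L), (L' \o L2); split; try exact: bij_comp.
by move=> X U /=; rewrite NL NL'.
Qed.

Lemma mulS_frob n (B a : M) :
  strongly_isotopic (V := V) (mulS p m k B a) (mulS p m k (B ^+ (p ^ n)) (a ^+ (p ^ n))).
Proof.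
pose L (X : V) : V := (X.1 ^+ (p ^ n), X.2 ^+ (p ^ n)).
have LD u v : L (u + v) = L u + L v by rewrite /L /= !frobD.
have Linj : injective L by move=> [x y] [u v] [/frob_inj-> /frob_inj->].
apply: (strongly_isotopicI LD LD Linj Linj) => -[x y] [u v]; rewrite /L /mulS /=.
have C z j : z ^+ j ^+ (p ^ n) = z ^+ (p ^ n) ^+ j by rewrite exprAC.
by congr pair; rewrite !frobD !exprMn !frobD !exprMn ?exprVn !C.
Qed.

Lemma rescaling_isotopic (B a B' a' : M) : B != 0 ->
  rescaling B (a / B) B' (a' / B') ->
  strongly_isotopic (V := V) (mulS p m k B a) (mulS p m k B' a').
Proof.
move=> B0 [t t0 [tB tal]].
pose L (X : V) : V := (t * X.1, X.2).
pose N (X : V) : V := (t ^+ (q + 1) * X.1, t ^+ (q * Q) * X.2).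
have LD u v : L (u + v) = L u + L v by rewrite /L /= mulrDr.
have ND u v : N (u + v) = N u + N v by rewrite /N /= !mulrDr.
have Linj : injective L by move=> [x y] [u v] [/(mulfI t0)-> ->].
have Ninj : injective N.
  by move=> [x y] [u v] [/(mulfI (expf_neq0 _ t0))-> /(mulfI (expf_neq0 _ t0))->].
apply: (strongly_isotopicI ND LD Ninj Linj) => -[x y] [u v]; rewrite /L /N /mulS /=.
rewrite -/q -/Q; congr pair.
  by rewrite -tB !exprMn addn1 !exprS; ring.
rewrite !exprMn mulrDr [_ * (a / B * _)]mulrA tal; ring.
Qed.

Lemma rescaling_swap_isotopic (B a B' a' : M) : B != 0 -> a != 0 -> B' != 0 -> a' != 0 ->
  rescaling B^-1 (a / B)^-1 B' (a' / B') ->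
  strongly_isotopic (V := V) (mulS p m k B a) (mulS p m k B' a').
Proof.
move=> B0 a0 B'0 a'0 [t t0 [tB tal]].
have al0 : a / B != 0 by rewrite mulf_neq0 ?invr_eq0.
have al'0 : a' / B' != 0 by rewrite mulf_neq0 ?invr_eq0.
pose L (X : V) : V := (t * X.2, X.1).
pose N (X : V) : V := (B' * X.1, t * (a' / B') * X.2).
have LD u v : L (u + v) = L u + L v by rewrite /L /= mulrDr.
have ND u v : N (u + v) = N u + N v by rewrite /N /= !mulrDr.
have Linj : injective L by move=> [x y] [u v] [/(mulfI t0)-> ->].
have Ninj : injective N.
  by move=> [x y] [u v] [/(mulfI B'0)-> /(mulfI (mulf_neq0 t0 al'0))->].
have tB' : B' * B = t ^+ (q + 1) by rewrite -tB mulfVK.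
have tal' : t * (a' / B') * (a / B) = t ^+ (q * Q) by rewrite -tal mulfVK.
apply: (strongly_isotopicI ND LD Ninj Linj) => -[x y] [u v]; rewrite /L /N /mulS /=.
rewrite -/q -/Q; congr pair.
  rewrite mulrDr [B' * (B * _)]mulrA tB' !exprMn addn1 exprS; ring.
rewrite mulrDr [t * _ * (a / B * _)]mulrA tal' !exprMn; ring.
Qed.

(** The first component is unchanged by the substitution of x ^ q and y ^ q for x
and y with m - k in place of k; in the second one, the Q-power map exchanges
the two halves, so that a / B is replaced by the inverse of (a / B) ^ Q. *)
Lemma mulS_dual (B a : M) : B != 0 -> a != 0 -> a ^+ Q = a ->
  strongly_isotopic (V := V) (mulS p m k B a) (mulS p m (m - k) B (B ^+ (Q + 1) / a)).
Proof.
move=> B0 a0 aQ; have k_le : (k <= m)%N by case: adm_k => _; lia.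
pose al := (a / B) ^+ Q.
have al0 : al != 0 by rewrite expf_neq0 // mulf_neq0 ?invr_eq0.
pose L (X : V) : V := (X.1 ^+ q, X.2 ^+ q).
pose N (X : V) : V := (X.1, al^-1 * X.2 ^+ Q).
have LD u v : L (u + v) = L u + L v by rewrite /L /= !frobD.
have ND u v : N (u + v) = N u + N v by rewrite /N /= frobD mulrDr.
have Linj : injective L by move=> [x y] [u v] [/frob_inj-> /frob_inj->].
have Ninj : injective N.
  by move=> [x y] [u v] [-> /(mulfI (invr_neq0 al0))/frob_inj->].
have al1 : B ^+ (Q + 1) / a / B = al^-1.
  by rewrite /al expr_div_n aQ addn1 exprSr; field; rewrite B0 a0 expf_neq0.
have qq x : x ^+ q ^+ (p ^ (m - k)) = x by rewrite -exprM -expnD subnKC // frob_card.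
apply: (strongly_isotopicI ND LD Ninj Linj) => -[x y] [u v]; rewrite /L /N /mulS /=.
rewrite -/q -/Q al1; congr pair; first by rewrite !qq; ring.
rewrite !exprM !qq -/q !frobD !exprMn !frobD !exprMn -/al !frobQK.
by rewrite -/Q -[a ^+ Q * _]exprMn -/al; field.
Qed.

(** * Linearized polynomials and extension of scalars *)

(** The coordinates of X after extension of scalars to M.  The shift e of the
letter y is m/2 on the operands of the multiplication and 0 on its values. *)
Definition emb (e : 'Z_m) (X : V) (g : bool * 'Z_m) : M :=
  if g.1 then X.2 ^+ (p ^ (g.2 + e)%R) else X.1 ^+ (p ^ g.2).

Hypothesis m_gt1 : (1 < m)%N.

Lemma frob_Zp_add (i j : 'Z_m) x : x ^+ (p ^ (i + j)%R) = x ^+ (p ^ i) ^+ (p ^ j).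
Proof.
have -> : (i + j)%R = ((i + j) %% m)%N :> nat by rewrite -[X in _ = (_ %% X)%N](Zp_cast m_gt1).
by rewrite frob_modn expnD exprM.
Qed.

Lemma frob_Zp_nat n x : x ^+ (p ^ (n%:R : 'Z_m)) = x ^+ (p ^ n).
Proof. by rewrite val_Zp_nat // frob_modn. Qed.

Lemma embD e X U g : emb e (X + U) g = emb e X g + emb e U g.
Proof. by rewrite /emb; case: g.1; rewrite /= frobD. Qed.

Lemma emb_frob e X s i j : emb e X (s, i + j) = emb e X (s, i) ^+ (p ^ j).
Proof.
by case: s; rewrite /emb -frob_Zp_add // addrAC.
Qed.

(** A linearized polynomial has degree less than p ^ m, the number of its roots if
it vanishes on M. *)
Lemma linearized_inj (a : 'Z_m -> M) :
  (forall x, \sum_i a i * x ^+ (p ^ i) = 0) -> forall i, a i = 0.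
Proof.
move=> a0; pose P := \sum_(i : 'Z_m) a i *: 'X^(p ^ i) : {poly M}.
have P0 : P = 0.
  apply/eqP; apply: contraT => Pn0.
  have := @max_poly_roots M P (enum (finvect_type M)) Pn0.
  have -> : all (root P) (enum (finvect_type M)).
    apply/allP=> x _; rewrite rootE /P horner_sum -[X in _ == X](a0 x).
    by apply/eqP; apply: eq_bigr => i _; rewrite hornerZ hornerXn.
  have sz : size (enum (finvect_type M) : seq M) = (p ^ m)%N by rewrite -card_field cardE.
  move=> /(_ isT (enum_uniq _)); rewrite sz ltnNge => /negP[]; apply: (leq_trans (size_sum _ _ _)).
  apply/bigmax_leqP => i _; apply: leq_trans (size_scale_leq _ _) _.
  rewrite size_polyXn ltn_exp2l ?prime_gt1 //.
  by rewrite -{2}(Zp_cast m_gt1) ltn_ord.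
move=> i; have := congr1 (fun R : {poly M} => R`_(p ^ i)) P0.
rewrite coef0 coef_sum (bigD1 i) //= coefZ coefXn eqxx mulr1 big1 ?addr0 // => j ji.
rewrite coefZ coefXn eqn_exp2l ?prime_gt1 // eq_sym.
by rewrite (inj_eq val_inj) (negPf ji) mulr0.
Qed.

Lemma sum_pairs (f : bool * 'Z_m -> M) :
  \sum_g f g = \sum_i f (false, i) + \sum_i f (true, i).
Proof.
transitivity (\sum_(s : bool) \sum_(i : 'Z_m) f (s, i)); last by rewrite big_bool addrC.
by rewrite pair_bigA; apply: eq_bigr => -[].
Qed.

Lemma emb_independent e (a : bool * 'Z_m -> M) :
  (forall X, \sum_g a g * emb e X g = 0) -> forall g, a g = 0.
Proof.
move=> a0.
have z n : 0 ^+ (p ^ n) = 0 :> M by rewrite expr0n expn_eq0 -leqn0 leqNgt prime_gt0.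
case=> [[] i].
  have := @linearized_inj (fun i => a (true, i - e)); move=> /(_ _ (i + e)).
  rewrite addrK => -> // x; rewrite -[RHS](a0 (0, x)) sum_pairs [X in _ = X + _]big1 ?add0r.
    rewrite (reindex_inj (addIr e)) /=; apply: eq_bigr => j _.
    by rewrite addrK.
  by move=> j _; rewrite /emb /= z mulr0.
apply: (@linearized_inj (fun i => a (false, i))) => x.
rewrite -[RHS](a0 (x, 0)) sum_pairs [X in _ = _ + X]big1 ?addr0 // => j _.
by rewrite /emb /= z mulr0.
Qed.

Let vb := vbasis (fullv : {vspace V}).
Let d : nat := \dim (fullv : {vspace V}).

Lemma dim_pairs : d = #|{: bool * 'Z_m}|.
Proof.
rewrite card_prod card_bool card_ord Zp_cast //.
have : \dim (fullv : {vspace V}) = (\dim (fullv : {vspace M}) + \dim (fullv : {vspace M}))%N.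
  by rewrite !dimvf.
by rewrite /d => ->; rewrite dimM mul2n addnn.
Qed.

Lemma additive_ext_basis (f f' : V -> M) :
    (forall u v, f (u + v) = f u + f v) -> (forall u v, f' (u + v) = f' u + f' v) ->
    (forall j : 'I_d, f vb`_j = f' vb`_j) ->
  f =1 f'.
Proof.
move=> fD f'D ff' X.
have sumf (g : V -> M) : (forall u v, g (u + v) = g u + g v) ->
    forall c : 'I_d -> nat, g (\sum_(j < d) vb`_j *+ c j) = \sum_(j < d) g vb`_j *+ c j.
  move=> gD c; have g0 : g 0 = 0 by apply: (addrI (g 0)); rewrite -gD !addr0.
  rewrite (big_morph g gD g0); apply: eq_bigr => j _.
  by elim: (c j) => [|n IHn]; rewrite ?mulr0n // !mulrS gD IHn.
have -> : X = \sum_(j < d) vb`_j *+ (coord vb j X : nat).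
  rewrite {1}(coord_vbasis (memvf X)); apply: eq_bigr => j _.
  by rewrite -[in LHS](natr_Zp (coord _ j X)) scaler_nat.
by rewrite !sumf //; apply: eq_bigr => j _; rewrite ff'.
Qed.

Let emb_mx e : 'M[M]_(#|{: bool * 'Z_m}|, d) := \matrix_(g, j) emb e vb`_j (enum_val g).

(** Evaluating the coordinate functions on a basis over F_p gives a square matrix,
invertible because these functions are independent over M. *)
Lemma emb_matrix_rank e : \rank (emb_mx e) = #|{: bool * 'Z_m}|.
Proof.
apply/eqP; rewrite -[_ == _]/(row_free _) -kermx_eq0; apply/eqP/row_matrixP => r.
rewrite row0; set v := row r _.
have vP : v *m emb_mx e = 0 by rewrite /v -row_mul mulmx_ker row0.
have v0 : forall g, v 0 (enum_rank g) = 0.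
  apply: (@emb_independent e) => X.
  have := @additive_ext_basis (fun X => \sum_g v 0 (enum_rank g) * emb e X g) (fun=> 0).
  apply => [u w|u w|j]; last first.
  - have vj : \sum_l v 0 l * emb e vb`_j (enum_val l) = 0.
      have := congr1 (fun R : 'rV_d => R 0 j) vP; rewrite !mxE => vPj.
      by rewrite -[RHS]vPj; apply: eq_bigr => l0 _; rewrite [emb_mx e _ _]mxE.
    rewrite -[RHS]vj (reindex (fun b : 'I_#|{: bool * 'Z_m}| => enum_val b)) /=.
      by apply: eq_bigr => g _; rewrite enum_valK.
    exact: onW_bij (enum_val_bij _).
  - by rewrite addr0.
  by rewrite -big_split /=; apply: eq_bigr => g _; rewrite embD mulrDr.
by apply/rowP=> g; rewrite -(enum_valK g) v0 mxE.
Qed.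

Lemma additive_linearized e (T : V -> M) : (forall u v, T (u + v) = T u + T v) ->
  exists a : bool * 'Z_m -> M, forall X, T X = \sum_g a g * emb e X g.
Proof.
move=> TD; have P_full : row_full (emb_mx e) by rewrite /row_full emb_matrix_rank dim_pairs.
have /submxP[D DE] : ((\row_(j < d) T vb`_j) <= emb_mx e)%MS by apply: submx_full.
exists (fun g => D 0 (enum_rank g)); apply: additive_ext_basis => // [u w|j].
  by rewrite -big_split /=; apply: eq_bigr => g _; rewrite embD mulrDr.
have := congr1 (fun R : 'rV_d => R 0 j) DE; rewrite !mxE => ->.
symmetry; rewrite (reindex (fun b : 'I_#|{: bool * 'Z_m}| => enum_val b)) /=.
  by apply: eq_bigr => g _; rewrite enum_valK mxE.
exact: onW_bij (enum_val_bij _).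
Qed.

Lemma emb_span e (x : bool * 'Z_m -> M) :
  exists c : 'I_d -> M, forall g, x g = \sum_j c j * emb e vb`_j g.
Proof.
have P_full : row_full (emb_mx e)^T by rewrite /row_full mxrank_tr emb_matrix_rank.
have /submxP[D DE] : ((\row_g x (enum_val g)) <= (emb_mx e)^T)%MS by apply: submx_full.
exists (fun j => D 0 j) => g.
have := congr1 (fun R : 'rV_(#|{: bool * 'Z_m}|) => R 0 (enum_rank g)) DE.
rewrite !mxE enum_rankK => ->; apply: eq_bigr => j _.
by rewrite !mxE enum_rankK.
Qed.

(** Every additive self-map of M x M is given by linearized polynomials, so it has
a matrix on the extended space. *)
Lemma additive_matrix e e' (f : V -> V) : (forall u v, f (u + v) = f u + f v) ->
  exists A : bool * 'Z_m -> bool * 'Z_m -> M,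
  forall X, emb e' (f X) =1 apply_mx A (emb e X).
Proof.
move=> fD.
have /fin_all_exists[A AE] : forall g, exists a : bool * 'Z_m -> M,
    forall X, emb e' (f X) g = \sum_g' a g' * emb e X g'.
  by move=> g; apply: additive_linearized => u v; rewrite fD embD.
by exists A => X g; rewrite AE.
Qed.

(** The Frobenius conjugates of a component of f are again components of f. *)
Lemma matrix_frob e e' (f : V -> V) A : (forall X, emb e' (f X) =1 apply_mx A (emb e X)) ->
  forall s i t j n, A (s, i + n) (t, j + n) = A (s, i) (t, j) ^+ (p ^ n).
Proof.
move=> AE s i t j n; apply/eqP; rewrite -subr_eq0; apply/eqP.
pose a (g : bool * 'Z_m) := A (s, i + n) g - A (s, i) (g.1, g.2 - n) ^+ (p ^ n).
suff a0 : forall g, a g = 0 by have := a0 (t, j + n); rewrite /a /= addrK.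
apply: (@emb_independent e) => X; rewrite /a.
under eq_bigr => g _ do rewrite mulrBl.
rewrite sumrB -[X in X - _]/(apply_mx A (emb e X) (s, i + n)) -AE emb_frob AE.
apply/eqP; rewrite subr_eq0; apply/eqP; rewrite /apply_mx.
rewrite (big_morph (fun x => x ^+ (p ^ n)) (frobD n) (_ : 0 ^+ (p ^ n) = 0)); last first.
  by rewrite expr0n expn_eq0 -leqn0 leqNgt prime_gt0.
rewrite [RHS](reindex (fun g : bool * 'Z_m => (g.1, g.2 + n))) /=.
  by apply: eq_bigr => -[u l'] _; rewrite /= addrK exprMn -emb_frob.
by exists (fun g => (g.1, g.2 - n)) => -[u l'] _ /=; rewrite ?addrK ?subrK.
Qed.

(** * The semifield multiplication after extension of scalars *)

Let h : 'Z_m := (m./2)%:R.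

Lemma half_Zp : h + h = 0.
Proof. by rewrite /h -natrD addnn even_halfK // -(Zp_cast m_gt1) Zp_cast // pchar_Zp. Qed.

Lemma half_neq0 : h != 0.
Proof.
apply/eqP=> /(congr1 val); rewrite /h /= val_Zp_nat // modn_small.
  by move/eqP; rewrite -leqn0 leqNgt half_gt0 m_gt1.
by rewrite ltn_half_double -addnn; lia.
Qed.

Lemma natr_Zp_eq0 n : ((n%:R : 'Z_m) == 0) = (m %| n)%N.
Proof. by rewrite -val_eqE /= val_Zp_nat. Qed.

Lemma double_eq0 (x : 'Z_m) : x + x = 0 -> x = 0 \/ x = h.
Proof.
have x_lt : (x < m)%N by rewrite -[X in (_ < X)%N](Zp_cast m_gt1) ltn_ord.
move/eqP; rewrite -[x]natr_Zp -natrD natr_Zp_eq0 => /dvdnP[[|[|j]] jE].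
- by left; rewrite (_ : x = 0%N :> nat) //; lia.
- right; congr (_%:R); rewrite -[LHS](doubleK x) -addnn jE mul1n //.
- lia.
Qed.

Lemma emb_true e X i : emb e X (true, i) = X.2 ^+ (p ^ (i + e)%R).
Proof. by []. Qed.

Lemma emb_false e X i : emb e X (false, i) = X.1 ^+ (p ^ i).
Proof. by []. Qed.

Lemma emb_half X i : emb h X (true, i + h) = X.2 ^+ (p ^ i).
Proof. by rewrite emb_true -addrA half_Zp addr0. Qed.

(** Structure constants of the extended multiplication.  With y ^ (p ^ (i + m/2))
as coordinate (true,i), the letters of x and y see the same positions, and the
coefficient of the square of the letter y at i is the conjugate of B ^ Q. *)
Definition twin_coef (B a : M) (s t : bool) (i : 'Z_m) : M :=
  (if s then (if t then B ^+ Q else 1) else (if t then a / B else 1)) ^+ (p ^ i).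

Lemma frob_half x (i : 'Z_m) : x ^+ (p ^ (i + h)%R) = x ^+ Q ^+ (p ^ i).
Proof. by rewrite addrC frob_Zp_add frob_Zp_nat. Qed.

Lemma coef_FF B a i : twin_coef B a false false i = 1.
Proof. by rewrite /twin_coef expr1n. Qed.
Lemma coef_TF B a i : twin_coef B a true false i = 1.
Proof. by rewrite /twin_coef expr1n. Qed.
Lemma coef_FT B a i : twin_coef B a false true i = (a / B) ^+ (p ^ i).
Proof. by []. Qed.
Lemma coef_TT B a i : twin_coef B a true true i = B ^+ Q ^+ (p ^ i).
Proof. by []. Qed.

Lemma emb_mulS k0 B a X U : emb 0 (mulS p m k0 B a X U) =1
  star h (twin_coef B a) k0%:R (emb h X) (emb h U).
Proof.
case: X U => [x y] [u v] [w i]; rewrite starE.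
have e1 (s : bool) j (T : V) : emb h T (s, j + k0%:R) = (emb h T (s, j)) ^+ (p ^ k0).
  by rewrite emb_frob frob_Zp_nat.
have e2 (T : V) : emb h T (false, i + h) = T.1 ^+ Q ^+ (p ^ i).
  by rewrite emb_false frob_half.
have e3 (T : V) : emb h T (true, i) = T.2 ^+ Q ^+ (p ^ i).
  by rewrite emb_true frob_half.
have C z j : z ^+ (p ^ i) ^+ j = z ^+ j ^+ (p ^ i) by rewrite exprAC.
case: w; rewrite -?[~~ true]/false -?[~~ false]/true !e1 ?e2 ?e3 !emb_half !emb_false !C.
- rewrite emb_true addr0 coef_FT coef_TF mul1r /mulS /=.
  rewrite !frobD !exprMn !frobD !exprMn -/Q.
  have E z : z ^+ (p ^ k0 * Q) ^+ (p ^ i) = z ^+ Q ^+ (p ^ k0) ^+ (p ^ i).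
    by rewrite mulnC exprM.
  by rewrite !E; ring.
- rewrite coef_FF coef_TT frob_half frobQK mul1r /mulS /=.
  by rewrite !frobD !exprMn !frobD !exprMn; ring.
Qed.

Lemma twin_coef_neq0 (B a : M) s t i : B != 0 -> a != 0 -> twin_coef B a s t i != 0.
Proof.
move=> B0 a0; rewrite /twin_coef expf_neq0 //.
by case: s; case: t; rewrite ?oner_neq0 ?expf_neq0 // mulf_neq0 ?invr_eq0.
Qed.

Lemma admissible_order k0 : admissible m k0 ->
  exists2 l0 : nat, odd l0 & (k0%:R : 'Z_m) *+ l0 = 0.
Proof.
move=> [_ _ odd_l0]; exists (m %/ gcdn k0 m)%N => //.
by apply/eqP; rewrite -mulrnA natr_Zp_eq0 dvdn_mul_order.
Qed.

Lemma odd_order_mul2 (x : 'Z_m) l0 : odd l0 -> x *+ l0 = 0 -> x *+ 2 = 0 -> x = 0.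
Proof.
move=> odd_l0 xl x2; move: xl; rewrite -(odd_double_half l0) odd_l0 mulrSr -mul2n mulrnA x2.
by rewrite mul0rn add0r.
Qed.

(** k has odd order in Z/m, so multiplying by 2 does not shrink the subgroup that
it generates. *)
Lemma admissible_mul8 k0 : admissible m k0 -> (k0%:R : 'Z_m) *+ 8 != 0.
Proof.
move=> adm_k0; have [l0 odd_l0 kl] := admissible_order adm_k0.
apply/negP=> /eqP k8; have kln n : (k0%:R : 'Z_m) *+ n *+ l0 = 0 by rewrite mulrnAC kl mul0rn.
have k4 : (k0%:R : 'Z_m) *+ 4 = 0 by apply: odd_order_mul2 odd_l0 (kln _) _; rewrite -mulrnA.
have k2 : (k0%:R : 'Z_m) *+ 2 = 0 by apply: odd_order_mul2 odd_l0 (kln _) _; rewrite -mulrnA.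
have /eqP := odd_order_mul2 odd_l0 kl k2; rewrite natr_Zp_eq0.
by case: adm_k0 => k1 k2' _ /dvdn_leq => /(_ k1); lia.
Qed.

(** The odd-order elements k0 and k1 cannot differ by m/2, which has order 2. *)
Lemma admissible_shift k0 k1 : admissible m k0 -> admissible m k1 ->
  (k0%:R : 'Z_m) + h != k1%:R.
Proof.
move=> /admissible_order[l0 odd0 k0l] /admissible_order[l1 odd1 k1l].
have hn n : h *+ n = h *+ odd n.
  by rewrite -[in LHS](odd_double_half n) mulrnDr -mul2n mulrnA mulr2n half_Zp mul0rn addr0.
apply/eqP=> /(congr1 (fun x : 'Z_m => x *+ (l0 * l1))); rewrite mulrnDl !mulrnA k0l mul0rn add0r.
rewrite -mulrnA hn oddM odd0 odd1 => /eqP.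
by rewrite -mulrnA mulnC mulrnA k1l mul0rn (negPf half_neq0).
Qed.

Lemma twin_coef_nondegenerate (B a : M) : nonsquare B -> a != 0 -> a ^+ Q = a ->
  forall i, twin_form h (twin_coef B a) k%:R false i != twin_form h (twin_coef B a) k%:R true i.
Proof.
move=> nsB a0 aQ i; have [B0 _] := nsB; have BQ0 : B ^+ Q != 0 by rewrite expf_neq0.
rewrite /twin_form [~~ true]/= [~~ false]/= !coef_FF !coef_TF !coef_FT !coef_TT.
rewrite !frob_half frobQK !mul1r !mulr1 -exprMn divfK //; apply/eqP => e.
apply: (norm_not_twisted_square nsB a0 aQ); apply: (@frob_inj i).
have down x : x ^+ (p ^ (i - k%:R)%R) ^+ q = x ^+ (p ^ i).
  by rewrite /q -frob_Zp_nat -frob_Zp_add subrK.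
have BQal : B ^+ Q * (a / B) ^+ Q = a by rewrite -exprMn mulrC divfK.
have C z j : z ^+ j ^+ (p ^ i) = z ^+ (p ^ i) ^+ j by rewrite exprAC.
move: ((a / B) ^+ Q) e BQal => alQ e BQal.
rewrite exprMn !C exprMn -[in X in _ * X]BQal !exprMn.
transitivity (B ^+ Q ^+ (p ^ i) ^+ q * (alQ ^+ (p ^ i) * a ^+ (p ^ (i - k%:R)%R)) ^+ q).
  by rewrite [in RHS]exprMn down; ring.
by rewrite e mulrC.
Qed.

(** By Frobenius equivariance a monomial matrix is determined by its columns at
position 0: the letter u s, the shift r s and the coefficient c s. *)
Lemma monomial_columns (A : bool * 'Z_m -> bool * 'Z_m -> M) :
    (forall s i t j n, A (s, i + n) (t, j + n) = A (s, i) (t, j) ^+ (p ^ n)) ->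
    (forall X, apply_mx A X =1 (fun=> 0) -> X =1 fun=> 0) ->
    (forall g, exists g', forall l, l != g' -> A l g = 0) ->
  exists (u : bool -> bool) (r : bool -> 'Z_m) (c : bool -> M),
    (forall s, c s != 0) /\
    (forall s i, apply_mx A (delta (s, i)) =1 fun g => c s ^+ (p ^ i) * delta (u s, i + r s) g).
Proof.
move=> Afrob A_inj Acol.
have /fin_all_exists[f fE] : forall s, exists g', forall l, l != g' -> A l (s, 0) = 0.
  by move=> s; apply: Acol.
exists (fun s => (f s).1), (fun s => (f s).2), (fun s => A (f s) (s, 0)).
have colE s i : apply_mx A (delta (s, i)) =1
    fun g => A (f s) (s, 0) ^+ (p ^ i) * delta ((f s).1, i + (f s).2) g.
  move=> [w j]; rewrite apply_delta /delta.
  have -> : A (w, j) (s, i) = A (w, j - i) (s, 0) ^+ (p ^ i).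
    by rewrite -Afrob subrK add0r.
  have -> : ((w, j) == ((f s).1, i + (f s).2)) = ((w, j - i) == f s).
    by case: (f s) => u r; rewrite !xpair_eqE /= subr_eq addrC.
  have [->|n] := eqVneq (w, j - i) (f s); first by rewrite mulr1.
  by rewrite fE // expr0n expn_eq0 -leqn0 leqNgt prime_gt0 // mulr0.
split=> // s; apply/eqP=> c0.
have s0 : apply_mx A (delta (s, 0)) =1 (fun=> 0).
  by move=> g; rewrite colE c0 expr0n expn_eq0 -leqn0 leqNgt prime_gt0 // mul0r.
by have /eqP := A_inj _ s0 (s, 0); rewrite /delta eqxx oner_eq0.
Qed.

Lemma matrix_cancel e e' f g A A' :
    (forall X, emb e' (f X) =1 apply_mx A (emb e X)) ->
    (forall X, emb e (g X) =1 apply_mx A' (emb e' X)) -> cancel f g ->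
  forall x : bool * 'Z_m -> M, apply_mx A' (apply_mx A x) =1 x.
Proof.
move=> AE A'E fK x i; have [c xE] := emb_span e x.
rewrite (apply_comb A' (apply_comb A xE)) xE; apply: eq_bigr => j _; congr (_ * _).
by rewrite -[in RHS](fK vb`_j) A'E; apply: apply_ext => l0; rewrite AE.
Qed.

Lemma matrix_bijection e e' (f : {linear V -> V}) : bijective f ->
  exists A : bool * 'Z_m -> bool * 'Z_m -> M,
  [/\ forall X, emb e' (f X) =1 apply_mx A (emb e X),
      forall x : bool * 'Z_m -> M, apply_mx A x =1 (fun=> 0) -> x =1 fun=> 0
    & forall x : bool * 'Z_m -> M, exists w, apply_mx A w =1 x].
Proof.
move=> [g fK gK]; have fD u v : f (u + v) = f u + f v by rewrite raddfD.
have gD u v : g (u + v) = g u + g v by apply: (can_inj fK); rewrite gK fD !gK.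
have [A AE] := additive_matrix e e' fD; have [A' A'E] := additive_matrix e' e gD.
have AK := matrix_cancel AE A'E fK; have A'K := matrix_cancel A'E AE gK.
exists A; split=> // [x x0 i|x]; last by exists (apply_mx A' x).
rewrite -AK (apply_ext A' x0) /apply_mx big1 // => j _; exact: mulr0.
Qed.

(** Both sides are bilinear over M and agree on M x M, which spans. *)
Lemma isotopism_extend k0 k1 (B a B' a' : M) (N L L2 : V -> V) AN A A2 :
    (forall X U, N (mulS p m k0 B a X U) = mulS p m k1 B' a' (L X) (L2 U)) ->
    (forall X, emb 0 (N X) =1 apply_mx AN (emb 0 X)) ->
    (forall X, emb h (L X) =1 apply_mx A (emb h X)) ->
    (forall X, emb h (L2 X) =1 apply_mx A2 (emb h X)) ->
  forall x u : bool * 'Z_m -> M, apply_mx AN (star h (twin_coef B a) k0%:R x u) =1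
    star h (twin_coef B' a') k1%:R (apply_mx A x) (apply_mx A2 u).
Proof.
move=> iso ANE AE A2E.
have emb_emb X U : apply_mx AN (star h (twin_coef B a) k0%:R (emb h X) (emb h U)) =1
    star h (twin_coef B' a') k1%:R (apply_mx A (emb h X)) (apply_mx A2 (emb h U)).
  move=> g; rewrite -(apply_ext AN (emb_mulS k0 B a X U)) -ANE iso emb_mulS.
  by apply: star_ext => i; rewrite ?AE ?A2E.
have emb_any X u : apply_mx AN (star h (twin_coef B a) k0%:R (emb h X) u) =1
    star h (twin_coef B' a') k1%:R (apply_mx A (emb h X)) (apply_mx A2 u).
  move=> g; have [c uE] := emb_span h u.
  rewrite (apply_comb AN (star_combr _ _ _ _ uE)) (star_combr _ _ _ _ (apply_comb A2 uE)).
  by apply: eq_bigr => j _; rewrite emb_emb.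
move=> x u g; have [c xE] := emb_span h x.
rewrite (apply_ext AN (starC _ _ _ _ _)) starC.
rewrite (apply_comb AN (star_combr _ _ _ _ xE)) (star_combr _ _ _ _ (apply_comb A xE)).
apply: eq_bigr => j _; rewrite starC -emb_any.
by congr (_ * _); apply: apply_ext; apply: starC.
Qed.

Lemma star_scale (c : bool -> bool -> 'Z_m -> M) (k0 : 'Z_m) (X U : bool * 'Z_m -> M) (a b : M) :
  star h c k0 (fun g => a * X g) (fun g => b * U g) =1 fun g => a * b * star h c k0 X U g.
Proof. by move=> [w i]; rewrite !starE; ring. Qed.

Lemma apply_scale (A : bool * 'Z_m -> bool * 'Z_m -> M) (X : bool * 'Z_m -> M) (a : M) :
  apply_mx A (fun g => a * X g) =1 fun g => a * apply_mx A X g.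
Proof.
by move=> g; rewrite /apply_mx mulr_sumr; apply: eq_bigr => j _; rewrite mulrCA.
Qed.

Lemma natr_dual : ((m - k)%:R : 'Z_m) = - k%:R.
Proof.
have km : (k <= m)%N by case: adm_k; lia.
by rewrite natrB // pchar_Zp // sub0r.
Qed.

(** * Comparing coefficients *)

(** The coefficients w, x of the first map of an isotopism and w', x' of the
second one are replaced by the ratios t = w / x and E = w' / w; the equations
force w' / w and x' / x to be conjugate, both being fixed by the q-power map. *)
Lemma ratio_equations (w w' x x' b0 al c1 c2 c3 c4 : M) :
    w != 0 -> w' != 0 -> x != 0 ->
    w * w' ^+ q = w ^+ q * w' -> x * w' ^+ Q ^+ q = w ^+ Q ^+ q * x' ->
    x * x' ^+ q * c2 = b0 * (w * w' ^+ q * c1) ->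
    w * x' ^+ Q ^+ q * c3 = al * (x * w' ^+ Q ^+ q * c4) ->
  exists t E, [/\ t != 0, E != 0, E ^+ q = E,
    t ^+ (q + 1) * b0 * E * c1 = E ^+ Q * c2 &
    t ^+ (q * Q) * al * E ^+ Q * c4 = t * E * c3].
Proof.
move=> w0 w'0 x0 eq1 eq3 eq4 eq5.
have [E E0 w'E] : exists2 E, E != 0 & w' = E * w.
  by exists (w' / w); rewrite ?mulf_neq0 ?invr_eq0 // divfK.
have [t t0 wt] : exists2 t, t != 0 & w = t * x.
  by exists (w / x); rewrite ?mulf_neq0 ?invr_eq0 // divfK.
have Eq : E ^+ q = E.
  apply: (mulfI (expf_neq0 q w0)); apply: (mulfI w0).
  move: eq1; rewrite w'E exprMn => eq1; transitivity (w * (E ^+ q * w ^+ q)); first by ring.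
  by rewrite eq1; ring.
have EQq : E ^+ Q ^+ q = E ^+ Q by rewrite exprAC Eq.
have x'E : x' = E ^+ Q * x.
  apply: (mulfI (expf_neq0 q (expf_neq0 Q w0))); rewrite -eq3 w'E !exprMn EQq; ring.
exists t, E; split=> //.
  have xq0 : x ^+ (q + 1) != 0 by rewrite expf_neq0.
  apply: (mulIf xq0); move: eq4; rewrite w'E x'E wt !exprMn Eq EQq !addn1 !exprS => eq4.
  transitivity (b0 * (t * x * (E * (t ^+ q * x ^+ q)) * c1)); first by ring.
  by rewrite -eq4; ring.
have xq0 : x * x ^+ (q * Q) != 0 by rewrite mulf_neq0 // expf_neq0.
apply: (mulIf xq0); move: eq5.
rewrite w'E x'E wt !exprMn frobQK Eq EQq -![_ ^+ Q ^+ q]exprM [(Q * q)%N]mulnC => eq5.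
transitivity (al * (x * (E ^+ Q * (t ^+ (q * Q) * x ^+ (q * Q))) * c4)); first by ring.
by rewrite -eq5; ring.
Qed.

(** An isotopism from exponent k0 to exponent k, extended to M, with its two maps
on the operands already in monomial form: letters u, v, shifts r, s and
coefficients la, mu. *)
Section Shape.
Variables (k0 : nat) (B a B' a' : M) (AN A A2 : bool * 'Z_m -> bool * 'Z_m -> M).
Hypotheses (adm_k0 : admissible m k0) (B0 : B != 0) (a0 : a != 0).
Hypotheses (B'0 : B' != 0) (a'0 : a' != 0).
Let c := twin_coef B a.
Let c' := twin_coef B' a'.
Let z0 : 'Z_m := k0%:R.
Let z : 'Z_m := k%:R.
Hypothesis isotopy : forall X U : bool * 'Z_m -> M,
  apply_mx AN (star h c z0 X U) =1 star h c' z (apply_mx A X) (apply_mx A2 U).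
Hypothesis AN_inj : forall X : bool * 'Z_m -> M, apply_mx AN X =1 (fun=> 0) -> X =1 fun=> 0.
Variables (u v : bool -> bool) (r s : bool -> 'Z_m) (la mu : bool -> M).
Hypotheses (la0 : forall t, la t != 0) (mu0 : forall t, mu t != 0).
Hypothesis AE : forall t i,
  apply_mx A (delta (t, i)) =1 fun g => la t ^+ (p ^ i) * delta (u t, i + r t) g.
Hypothesis A2E : forall t i,
  apply_mx A2 (delta (t, i)) =1 fun g => mu t ^+ (p ^ i) * delta (v t, i + s t) g.
Hypothesis u_inj : injective u.

Let z0_2 : z0 + z0 != 0.
Proof.
apply/eqP=> z2; case/eqP: (admissible_mul8 adm_k0).
by rewrite -/z0 -[8%N]/(2 * 4)%N mulrnA mulr2n z2 mul0rn.
Qed.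
Let z_2 : z + z != 0.
Proof.
apply/eqP=> z2; case/eqP: (admissible_mul8 adm_k).
by rewrite -/z -[8%N]/(2 * 4)%N mulrnA mulr2n z2 mul0rn.
Qed.

(** The image of a product of basis vectors, computed with the two operands in
either order, determines a column of AN in two ways. *)
Lemma image_of_product b t i : forall g,
  c b t i * AN g (b (+) t, i + h *+ b) =
  la b ^+ (p ^ i) * mu t ^+ (p ^ (i + z0)%R)
   * star h c' z (delta (u b, i + r b)) (delta (v t, i + z0 + s t)) g.
Proof.
move=> g; rewrite -star_scale.
rewrite -(star_ext h c' z (AE b i) (A2E t (i + z0))) -isotopy.
rewrite (apply_ext _ (star_delta_delta half_Zp c b t i z0_2)) apply_scale.
by rewrite apply_delta.
Qed.

Lemma image_of_product_swapped b t i : forall g,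
  c b t i * AN g (b (+) t, i + h *+ b) =
  la t ^+ (p ^ (i + z0)%R) * mu b ^+ (p ^ i)
   * star h c' z (delta (u t, i + z0 + r t)) (delta (v b, i + s b)) g.
Proof.
move=> g; rewrite -star_scale.
rewrite -(star_ext h c' z (AE t (i + z0)) (A2E b i)) -isotopy.
rewrite (apply_ext _ (starC h c z0 _ _)).
rewrite (apply_ext _ (star_delta_delta half_Zp c b t i z0_2)) apply_scale.
by rewrite apply_delta.
Qed.

Lemma image_neq0 b t i : ~ (fun g => c b t i * AN g (b (+) t, i + h *+ b)) =1 fun=> 0.
Proof.
move=> E; have d0 : delta (b (+) t, i + h *+ b) =1 (fun=> 0 : M).
  apply: AN_inj => g; rewrite apply_delta.
  by apply: (mulfI (twin_coef_neq0 b t i B0 a0)); rewrite mulr0; apply: E.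
by have /eqP := d0 (b (+) t, i + h *+ b); rewrite /delta eqxx oner_eq0.
Qed.

(** The basis vectors b(b,0) and b(t,k0), and likewise b(b,k0) and b(t,0), have a
non-zero product, so their images are neighbours.  The two conditions give
2 (s t - r b) = 0, and the difference m/2 is excluded by [admissible_shift]. *)
Lemma shifts_equal b t : s t = r b /\ (z = z0 \/ z = - z0).
Proof.
have up : z0 + s t = r b + z \/ r b = z0 + s t + z.
  have := @star_delta_neq0 _ _ h half_Zp c' z (u b) (v t) (0 + r b) (0 + z0 + s t).
  rewrite !add0r; apply.
  by move=> E; apply: (@image_neq0 b t 0) => g; rewrite image_of_product !add0r E mulr0.
have down : s t = z0 + r b + z \/ z0 + r b = s t + z.
  have := @star_delta_neq0 _ _ h half_Zp c' z (u b) (v t) (0 + z0 + r b) (0 + s t).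
  rewrite !add0r; apply.
  by move=> E; apply: (@image_neq0 t b 0) => g; rewrite image_of_product_swapped !add0r E mulr0.
have DE : s t - r b + r b = s t by rewrite subrK.
move: (s t - r b) DE => D DE; rewrite -DE in up down *.
have adm_k' : admissible m (m - k) by apply: admissible_dual.
have NhE : - h = h by apply/eqP; rewrite eq_sym -addr_eq0 half_Zp.
case: up => up; case: down => down.
- case/eqP: z0_2; have zE : z = z0 + D by apply: (addrI (r b)); rewrite -up; ring.
  have : D = z0 + z by apply: (addIr (r b)); rewrite down; ring.
  by rewrite zE => e; apply: (addIr D); rewrite add0r [RHS]e; ring.
- have zE : z = z0 + D by apply: (addrI (r b)); rewrite -up; ring.
  have : D + D = 0.
    apply: (addIr (z0 + r b)); rewrite add0r [RHS]down zE; ring.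
  case/double_eq0=> D0; first by move: zE; rewrite D0 add0r addr0; split; [|left].
  by have := admissible_shift adm_k0 adm_k; rewrite -/z0 -/z zE D0 eqxx.
- have zE : z = - (z0 + D).
    apply/eqP; rewrite -addr_eq0; apply/eqP/(addIr (r b)).
    by rewrite add0r [RHS]up; ring.
  have : D + D = 0.
    by apply: (addIr (z0 + r b + z)); rewrite add0r -[RHS]down zE; ring.
  case/double_eq0=> D0; first by move: zE; rewrite D0 add0r addr0; split; [|right].
  have := admissible_shift adm_k0 adm_k'; rewrite natr_dual -/z0 -/z zE opprK D0 eqxx //.
- case/eqP: z0_2; have zE : z = - (z0 + D).
    apply/eqP; rewrite -addr_eq0; apply/eqP/(addIr (r b)).
    by rewrite add0r [RHS]up; ring.
  have e : z0 = D + z by apply: (addIr (r b)); rewrite down; ring.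
  by rewrite {1}e zE; ring.
Qed.

Hypothesis k0_k : k0 = k.

Lemma product_forward b t i g :
  c b t i * AN g (b (+) t, i + h *+ b) =
  la b ^+ (p ^ i) * mu t ^+ (p ^ (i + z)%R) * c' (u b) (v t) (i + r false) *
    delta (u b (+) v t, i + r false + h *+ u b) g.
Proof.
have [st _] := shifts_equal false t; have [st' _] := shifts_equal b t.
have rb : r b = r false by rewrite -st' st.
rewrite image_of_product rb st -/z0 (_ : z0 = z) /z0 ?k0_k //.
by rewrite addrAC (star_delta_delta half_Zp) // mulrA.
Qed.

Lemma product_backward b t i g :
  c b t i * AN g (b (+) t, i + h *+ b) =
  la t ^+ (p ^ (i + z)%R) * mu b ^+ (p ^ i) * c' (v b) (u t) (i + r false) *
    delta (v b (+) u t, i + r false + h *+ v b) g.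
Proof.
have [sb _] := shifts_equal false b; have [sb' _] := shifts_equal t b.
have rt : r t = r false by rewrite -sb' sb.
rewrite image_of_product_swapped rt sb -/z0 (_ : z0 = z) /z0 ?k0_k //.
by rewrite starC [i + _ + r false]addrAC (star_delta_delta half_Zp) // mulrA.
Qed.

Let c'0 b t i : c' b t i != 0. Proof. exact: twin_coef_neq0. Qed.

(** The square of the letter b is symmetric in the two operands, but the twist of
its image is governed by u b in one order and by v b in the other. *)
Lemma same_letters b : u b = v b.
Proof.
have := product_backward b b 0 (u b (+) v b, 0 + r false + h *+ u b).
rewrite product_forward {1}/delta eqxx mulr1 /delta xpair_eqE.
rewrite (inj_eq (addrI _)) (twist_inj half_neq0).
have [//|ne] := eqVneq (u b) (v b); rewrite andbF mulr0 => /eqP.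
have := mulf_neq0 (expf_neq0 (p ^ (0 : 'Z_m)%R) (la0 b)) (expf_neq0 (p ^ (0 + z)%R) (mu0 b)).
by move/mulf_neq0/(_ (c'0 (u b) (v b) (0 + r false)))/negPf->.
Qed.

Let w := la false.
Let w' := mu false.
Let x1 := la true ^+ Q.
Let x1' := mu true ^+ Q.
Let e := u false.
Let rr := r false.
Let hE (j : bool) : h + h *+ ~~ j = h *+ j.
Proof. by case: j; rewrite /= ?addr0 ?mulr1n // half_Zp. Qed.

(** Each column of AN at position 0 is reached from the letters (false,false) and
(true,true), respectively (false,true) and (true,false), and in both orders of
the operands. *)
Lemma shape_equations :
  [/\ w * w' ^+ q = w ^+ q * w',
      x1 * x1' ^+ q = x1 ^+ q * x1',
      x1 * w' ^+ Q ^+ q = w ^+ Q ^+ q * x1',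
      x1 * x1' ^+ q * c' (~~ e) (~~ e) (h + rr) = B * (w * w' ^+ q * c' e e rr)
    & w * x1' ^+ Q ^+ q * c' e (~~ e) rr = (a / B) * (x1 * w' ^+ Q ^+ q * c' (~~ e) e (h + rr))].
Proof.
have ut : u true = ~~ e.
  by have := u_inj (x1 := true) (x2 := false); rewrite -/e; case: (u true) e => [] [] // /(_ erefl).
have z00 (X : M) : X ^+ (p ^ (0%R : 'Z_m)) = X by rewrite expn0 expr1.
have zz (X : M) : X ^+ (p ^ z) = X ^+ q by rewrite frob_Zp_nat.
have zh (X : M) : X ^+ (p ^ h) = X ^+ Q by rewrite frob_Zp_nat.
have zhz (X : M) : X ^+ (p ^ (h + z)%R) = X ^+ Q ^+ q by rewrite frob_Zp_add zh zz.
have dd (g : bool * 'Z_m) : delta g g = 1 :> M by rewrite /delta eqxx.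
have fwd b t i : i + h *+ u b = h *+ e ->
    c b t i * AN (u b (+) u t, rr + h *+ e) (b (+) t, i + h *+ b) =
    la b ^+ (p ^ i) * mu t ^+ (p ^ (i + z)%R) * c' (u b) (u t) (i + rr).
  move=> ie; rewrite product_forward -(same_letters t) -/rr.
  have -> : i + rr + h *+ u b = rr + h *+ e by rewrite -ie; ring.
  by rewrite dd mulr1.
have bwd b t i : i + h *+ u b = h *+ e ->
    c b t i * AN (u b (+) u t, rr + h *+ e) (b (+) t, i + h *+ b) =
    la t ^+ (p ^ (i + z)%R) * mu b ^+ (p ^ i) * c' (u b) (u t) (i + rr).
  move=> ie; rewrite product_backward -(same_letters b) -/rr.
  have -> : i + rr + h *+ u b = rr + h *+ e by rewrite -ie; ring.
  by rewrite dd mulr1.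
have i0 : 0 + h *+ u false = h *+ e by rewrite add0r.
have ih : h + h *+ u true = h *+ e by rewrite ut hE.
have cTT : c true true h = B by rewrite /c coef_TT zh frobQK.
have := (fwd _ true _ ih, bwd _ true _ ih, (fwd _ false _ ih, bwd _ false _ ih)).
have := (fwd _ true _ i0, bwd _ true _ i0, (fwd _ false _ i0, bwd _ false _ i0)).
rewrite ut -/e cTT /c coef_FF coef_FT coef_TF !z00 !add0r !zz zh zh !zhz.
rewrite [~~ e (+) e]addbC !addbb.
rewrite ![(h *+ _)]/= ![h *+ true]mulr1n half_Zp !mul1r mulr0n.
move=> [[G1 G1s] [F1 F1s]] [[F2 F2s] [G2 G2s]]; rewrite /w /w' /x1 /x1' frobQK; split.
- by apply: (mulIf (c'0 e e rr)); rewrite -F1 -F1s.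
- by apply: (mulIf (c'0 (~~ e) (~~ e) (h + rr))); rewrite -F2 -F2s.
- by apply: (mulIf (c'0 (~~ e) e (h + rr))); rewrite -G2 -G2s.
- by rewrite -F2 -F1.
- by rewrite -G1 -G2.
Qed.

Definition rescaling_up_to_twist (b0 al : M) := exists n : nat,
  let b1 := B' ^+ (p ^ n) in let al1 := (a' / B') ^+ (p ^ n) in
  rescaling b0 al b1 al1 \/ rescaling b0 al b1 (- al1).

(** The isotopism keeps the letters when e is false; when it exchanges them, the
roles of t and of its inverse are exchanged too and the twist gains m/2. *)
Lemma shape_rescaling :
  rescaling_up_to_twist B (a / B) \/ rescaling_up_to_twist B^-1 (a / B)^-1.
Proof.
have [eq1 eq2 eq3 eq4 eq5] := shape_equations.
have w0 : w != 0 by exact: la0.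
have w'0 : w' != 0 by exact: mu0.
have x0 : x1 != 0 by rewrite expf_neq0 // la0.
have al0 : a / B != 0 by rewrite mulf_neq0 ?invr_eq0.
have [t [E [t0 E0 Eq main1 main2]]] := ratio_equations w0 w'0 x0 eq1 eq3 eq4 eq5.
have EQq : E ^+ Q ^+ q = E ^+ Q by rewrite exprAC Eq.
move: main1 main2; case: e => /= main1 main2; [right | left]; last first.
  exists rr; apply: (rescaling_up_to_sign t0 E0 Eq).
    move: main1; rewrite /c' coef_FF coef_TT addrC frob_half frobQK mulr1 => ->.
    by rewrite mulrC.
  move: main2; rewrite /c' coef_FT coef_TF mulr1 => ->; ring.
exists (rr + h)%R; apply: (@rescaling_up_to_sign _ _ _ _ t^-1 (E ^+ Q)).
- by rewrite invr_eq0.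
- by rewrite expf_neq0.
- exact: EQq.
- rewrite frobQK frob_half exprVn.
  have tq0 : t ^+ (q + 1) != 0 by rewrite expf_neq0.
  apply: (mulfI tq0); apply: (mulfI B0).
  move: main1; rewrite /c' coef_FF coef_TT mulr1 => main1.
  transitivity (E ^+ Q); first by field; rewrite tq0 B0.
  by rewrite -main1; ring.
- rewrite frobQK frob_half exprVn.
  have tq0 : t ^+ (q * Q) != 0 by rewrite expf_neq0.
  apply: (mulfI tq0); apply: (mulfI t0); apply: (mulfI al0).
  move: main2; rewrite /c' coef_FT coef_TF mulr1 addrC frob_half => main2.
  transitivity (t * E).
    by move: (a / B) al0 => al al0; field; rewrite tq0 al0.
  by rewrite -main2; move: (_ ^+ (p ^ rr)) (a / B) => y al; field.
Qed.
End Shape.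

(** * Classification of isotopisms *)

Lemma isotopic_shape k0 (B a B' a' : M) :
    admissible m k0 -> B != 0 -> a != 0 -> nonsquare B' -> a' != 0 -> a' ^+ Q = a' ->
    isotopic (V := V) (mulS p m k0 B a) (mulS p m k B' a') ->
  ((k%:R : 'Z_m) = k0%:R \/ (k%:R : 'Z_m) = - k0%:R) /\
  (k0 = k -> rescaling_up_to_twist B' a' B (a / B) \/
             rescaling_up_to_twist B' a' B^-1 (a / B)^-1).
Proof.
move=> adm_k0 B0 a0 nsB' a'0 a'Q [N [L1 [L2 [Nb L1b L2b iso]]]].
have [B'0 _] := nsB'.
have [AN [ANE AN_inj _]] := matrix_bijection 0 0 Nb.
have [A [AE A_inj A_surj]] := matrix_bijection h h L1b.
have [A2 [A2E A2_inj A2_surj]] := matrix_bijection h h L2b.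
have ext := isotopism_extend iso ANE AE A2E.
have ext' X U : apply_mx AN (star h (twin_coef B a) k0%:R X U) =1
    star h (twin_coef B' a') k%:R (apply_mx A2 X) (apply_mx A U).
  move=> g; rewrite (apply_ext AN (starC h (twin_coef B a) k0%:R X U)) ext.
  exact: starC.
have z0_2 : (k0%:R : 'Z_m) + k0%:R != 0.
  apply/eqP=> z2; case/eqP: (admissible_mul8 adm_k0).
  by rewrite -[8%N]/(2 * 4)%N mulrnA mulr2n z2 mul0rn.
have c'0 b t i := twin_coef_neq0 b t i B'0 a'0.
have colA := column_monomial half_Zp half_neq0 double_eq0 z0_2 (admissible_mul8 adm_k) c'0
  (twin_coef_nondegenerate nsB' a'0 a'Q) ext A_inj A2_surj.
have colA2 := column_monomial half_Zp half_neq0 double_eq0 z0_2 (admissible_mul8 adm_k) c'0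
  (twin_coef_nondegenerate nsB' a'0 a'Q) ext' A2_inj A_surj.
have [u [r [la [la0 laE]]]] := monomial_columns (matrix_frob AE) A_inj colA.
have [v [s [mu [mu0 muE]]]] := monomial_columns (matrix_frob A2E) A2_inj colA2.
have shifts := shifts_equal adm_k0 B0 a0 ext AN_inj laE muE.
have [s0 kk0] := shifts false false; split=> // k0_k.
have u_inj : injective u.
  (* otherwise two columns of A would be proportional *)
  have r_eq : r true = r false by rewrite -(shifts true false).1 s0.
  suff neq : u true <> u false by move=> [] [] // E; case: neq; rewrite E.
  move=> u_eq; pose X (g : bool * 'Z_m) : M :=
    la false * delta (true, 0) g - la true * delta (false, 0) g.
  have X0 : X =1 fun=> 0.
    apply: A_inj => g; rewrite /X.
    have -> : apply_mx A X g = la false * apply_mx A (delta (true, 0)) g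
        - la true * apply_mx A (delta (false, 0)) g.
      rewrite /apply_mx !mulr_sumr -sumrB; apply: eq_bigr => j _; rewrite /X; ring.
    by rewrite !laE r_eq u_eq expn0 !expr1; ring.
  have := X0 (true, 0); rewrite /X /delta !xpair_eqE /= mulr0 subr0 mulr1 => /eqP.
  by rewrite (negPf (la0 _)).
exact: (shape_rescaling adm_k0 B0 a0 B'0 a'0 ext AN_inj la0 mu0 laE muE u_inj k0_k).
Qed.

Lemma rescaling_opp b0 al b1 al1 : rescaling b0 al b1 al1 -> rescaling b0 (- al) b1 (- al1).
Proof. by move=> [t t0 [tb tal]]; exists t => //; rewrite !mulrN tal. Qed.

(** A further twist by the Q-power map turns the sign of a' around. *)
Lemma rescaling_remove_sign (B' a' b0 al : M) : nonsquare B' -> a' ^+ Q = a' ->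
    rescaling_up_to_twist B' a' b0 al ->
  exists n, rescaling b0 al (B' ^+ (p ^ n)) (a' ^+ (p ^ n) / B' ^+ (p ^ n)).
Proof.
move=> nsB' a'Q [n /= []]; rewrite expr_div_n => D; first by exists n.
exists (n + m./2)%N; rewrite !expnD !exprM -expr_div_n.
apply: rescaling_trans D _; rewrite -[X in rescaling _ _ _ X]opprK.
apply: rescaling_opp; apply: rescaling_conj; first exact: nonsquare_frob.
by rewrite exprAC a'Q.
Qed.

Lemma isotopic_rescaling (B a B' a' : M) :
    nonsquare B -> a != 0 -> nonsquare B' -> a' != 0 -> a' ^+ Q = a' ->
    isotopic (V := V) (mulS p m k B a) (mulS p m k B' a') ->
  exists n : 'I_m,
    rescaling B (a / B) (B' ^+ (p ^ n)) (a' ^+ (p ^ n) / B' ^+ (p ^ n)) \/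
    rescaling B^-1 (a / B)^-1 (B' ^+ (p ^ n)) (a' ^+ (p ^ n) / B' ^+ (p ^ n)).
Proof.
move=> [B0 _] a0 nsB' a'0 a'Q /(isotopic_shape adm_k B0 a0 nsB' a'0 a'Q)[_ /(_ erefl)].
by case=> /(rescaling_remove_sign nsB' a'Q)[n D]; exists (Ordinal (ltn_pmod n m_gt0));
  [left | right]; rewrite /= !frob_modn.
Qed.

Lemma isotopic_strongly_isotopic (B a B' a' : M) :
    nonsquare B -> a != 0 -> nonsquare B' -> a' != 0 -> a' ^+ Q = a' ->
    isotopic (V := V) (mulS p m k B a) (mulS p m k B' a') ->
  strongly_isotopic (V := V) (mulS p m k B a) (mulS p m k B' a').
Proof.
move=> nsB a0 nsB' a'0 a'Q /isotopic_rescaling[]// n D.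
apply: strongly_isotopic_trans (strongly_isotopic_sym (mulS_frob n B' a')).
have [B0 _] := nsB; have [B'0 _] := nsB'.
case: D => D; first exact: rescaling_isotopic.
by apply: rescaling_swap_isotopic; rewrite ?expf_neq0.
Qed.

(** t is determined up to sign by t ^ (q+1), and q Q is odd. *)
Lemma rescaling_unique b0 al b1 al1 al2 : b0 != 0 ->
  rescaling b0 al b1 al1 -> rescaling b0 al b1 al2 -> al1 = al2.
Proof.
move=> b00 [t t0 [tb tal]] [u u0 [ub ual]].
have /expq1_inj[tu|tu] : t ^+ (q + 1) = u ^+ (q + 1) by apply: (mulIf b00); rewrite tb ub.
  by apply: (mulfI u0); rewrite -ual -tu tal.
apply: (mulfI u0); rewrite -ual -[u]opprK -tu /q /Q -expnD frobN expnD -/q -/Q.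
by rewrite !mulNr tal.
Qed.

Lemma mulS_opp (B a : M) : nonsquare B -> a ^+ Q = a ->
  strongly_isotopic (V := V) (mulS p m k B a) (mulS p m k B (- a)).
Proof.
move=> nsB aQ; have [B0 _] := nsB.
apply: (@strongly_isotopic_trans _ (mulS p m k (B ^+ Q) (- a))).
  apply: rescaling_isotopic => //.
  by have := rescaling_conj nsB aQ; rewrite expr_div_n aQ -mulNr.
have := mulS_frob m./2 B (- a); rewrite frobN -/Q aQ; exact: strongly_isotopic_sym.
Qed.

(** B' / B is a square, hence t ^ (q+1) for some t; then a' is a times the q-th
power of the norm of t to L. *)
Lemma mulS_change_base (B B' a : M) : nonsquare B -> nonsquare B' -> a != 0 -> a ^+ Q = a ->
  exists a', [/\ a' ^+ Q = a', a' != 0 &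
    isotopic (V := V) (mulS p m k B a) (mulS p m k B' a')].
Proof.
move=> nsB nsB' a0 aQ; have [B0 _] := nsB; have [w w0 B'E] := nonsquareM nsB nsB'.
have [t t0 tE] := expq1_surj w0; have tQ0 : t ^+ Q != 0 by rewrite expf_neq0.
exists (a * (t * t ^+ Q) ^+ q); split.
- by rewrite exprMn aQ exprAC exprMn frobQK [t ^+ Q * t]mulrC.
- by rewrite mulf_neq0 // expf_neq0 // mulf_neq0.
apply/strongly_isotopic_isotopic/rescaling_isotopic => //.
exists t => //; split; first by rewrite tE B'E mulrC.
rewrite B'E -tE addn1 exprS exprMn -[t ^+ Q ^+ q]exprM [(Q * q)%N]mulnC.
by field; rewrite B0 expf_neq0 // t0.
Qed.

End FiniteField.

(** Counting through a relation: each element of s has a code and no code is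
shared, but no coding function has to be chosen. *)
Lemma size_le_codes (T C : eqType) (R : C -> T -> Prop) (s : seq T) (cs : seq C) :
    uniq s -> (forall x, x \in s -> exists2 c, c \in cs & R c x) ->
    (forall c x y, R c x -> R c y -> x = y) ->
  (size s <= size cs)%N.
Proof.
move=> s_uniq codes R_inj.
suff [t [t_uniq <- tP]] : exists t, [/\ uniq t, size t = size s &
    forall c, c \in t -> c \in cs /\ exists2 x, x \in s & R c x].
  by apply: uniq_leq_size => // c /tP[].
elim: s s_uniq codes => [|x s IHs] /= => [_ _|/andP[xs s_uniq] codes]; first by exists [::].
have [y ys|t [t_uniq t_size tP]] := IHs s_uniq.
  by apply: codes; rewrite inE ys orbT.
have [c c_cs Rcx] := codes x (mem_head _ _).
exists (c :: t); split=> [|/=|c']; last 2 first.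
- by rewrite t_size.
- rewrite inE => /predU1P[->|/tP[c'_cs [y ys Rcy]]].
    by split=> //; exists x; rewrite ?mem_head.
  by split=> //; exists y; rewrite // inE ys orbT.
rewrite /= t_uniq andbT; apply/negP=> /tP[_ [y ys Rcy]].
by rewrite (R_inj _ _ _ Rcx Rcy) ys in xs.
Qed.

Theorem theorem6p2 (p m : nat) (p_prime : prime p) (p_odd : odd p)
    (m_gt0 : (0 < m)%N) (m_even : ~~ odd m)
    (M : fieldExtType 'F_p) (dimM : \dim {: M} = m)
    (L : {subfield M}) (dimL : \dim L = m./2) :
  let Q := (p ^ m./2)%N in
  let n := (2 * m)%N in
  let iso (k : nat) (B a : M) (k' : nat) (B' a' : M) :=
    isotopic (V := (M * M)%type) (mulS p m k B a) (mulS p m k' B' a') in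
  let strong_iso (k : nat) (B a : M) (k' : nat) (B' a' : M) :=
    strongly_isotopic (V := (M * M)%type)
      (mulS p m k B a) (mulS p m k' B' a') in
  (* (i) *)
  (forall (k k' : nat) (B B' a a' : M),
     admissible m k -> admissible m k' -> nonsquare B -> nonsquare B' ->
     a \in L -> a != 0 -> a' \in L -> a' != 0 ->
     iso k B a k' B' a' <-> strong_iso k B a k' B' a') /\
  (* (ii) *)
  (forall (k : nat) (B a : M),
     admissible m k -> nonsquare B -> a \in L -> a != 0 ->
     let a' := B ^+ (Q + 1) / a in
     [/\ admissible m (m - k), a' \in L, a' != 0 & iso k B a (m - k)%N B a']) /\
  (* (iii) *)
  (forall (k : nat) (B B' a : M),
     admissible m k -> nonsquare B -> nonsquare B' -> a \in L -> a != 0 ->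
     exists a' : M, [/\ a' \in L, a' != 0 & iso k B a k B' a']) /\
  (* (iv) *)
  (forall (k : nat) (B a a' : M),
     admissible m k -> nonsquare B ->
     a \in L -> a != 0 -> a' \in L -> a' != 0 ->
     iso k B a k B a' -> iso k B a k B (- a')) /\
  (* (v) *)
  (forall (k : nat) (B a : M),
     admissible m k -> nonsquare B -> a \in L -> a != 0 ->
     forall s : seq M, uniq s ->
     (forall a' : M, a' \in s -> [/\ a' \in L, a' != 0 & iso k B a k B a']) ->
     (size s <= n)%N) /\
  (* (vi) *)
  (forall (k k' : nat) (B B' a a' : M),
     admissible m k -> admissible m k' -> nonsquare B -> nonsquare B' ->
     a \in L -> a != 0 -> a' \in L -> a' != 0 ->
     iso k B a k' B' a' ->
     (p ^ k')%N = (p ^ k)%N \/ (p ^ k')%N = (p ^ (m - k))%N).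
Proof.
move=> Q n iso strong_iso.
have m_gt1 : (1 < m)%N by case: (m) m_gt0 m_even => [|[]].
have memL x : (x \in L) = (x ^+ Q == x) by rewrite (mem_subfield p_prime L) dimL.
have fixL x : x \in L -> x ^+ Q = x by rewrite memL => /eqP.
have lt_m k : admissible m k -> (k < m)%N.
  by case=> _ km _; rewrite -(subnK m_gt0) addn1 ltnS.
have exponents k k' B B' a a' : admissible m k -> admissible m k' ->
    nonsquare B -> nonsquare B' -> a \in L -> a != 0 -> a' \in L -> a' != 0 ->
    iso k B a k' B' a' -> k' = k \/ k' = (m - k)%N.
  move=> adm adm' [B0 _] nsB' aL a0 a'L a'0.
  move/(isotopic_shape p_prime p_odd m_gt0 dimM m_even adm' m_gt1 adm B0 a0 nsB' a'0 (fixL _ a'L)).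
  case=> kk' _; have [k1 k2 _] := adm; have [k'1 k'2 _] := adm'.
  case: kk' => /eqP.
    by rewrite -val_eqE /= !val_Zp_nat // !modn_small ?lt_m // => /eqP; left.
  rewrite -addr_eq0 -natrD natr_Zp_eq0 // => /dvdnP[j jE]; right.
  move: j jE k1 (lt_m k adm) (lt_m k' adm'); clear => -[|[|j]]; nia.
have dual k B a : admissible m k -> nonsquare B -> a \in L -> a != 0 ->
    let a' := B ^+ (Q + 1) / a in
    [/\ admissible m (m - k), a' \in L, a' != 0 & strong_iso k B a (m - k)%N B a'].
  move=> adm [B0 nsB] aL a0 a'; split.
  - exact: admissible_dual.
  - rewrite memL /a' expr_div_n (fixL _ aL) addn1 exprS exprMn.
    by rewrite (frobQK p_prime dimM m_even) [B ^+ Q * B]mulrC.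
  - by rewrite mulf_neq0 ?invr_eq0 // expf_neq0.
  exact: (mulS_dual p_prime p_odd m_gt0 dimM m_even adm B0 a0 (fixL _ aL)).
split; [|split; [|split; [|split; [|split]]]].
- move=> k k' B B' a a' adm adm' nsB nsB' aL a0 a'L a'0.
  split; last exact: strongly_isotopic_isotopic.
  have same k1 B1 a1 a2 : admissible m k1 -> nonsquare B1 -> a1 \in L -> a1 != 0 -> a2 \in L ->
      a2 != 0 -> iso k1 B1 a1 k1 B' a2 -> strong_iso k1 B1 a1 k1 B' a2.
    move=> adm1 nsB1 a1L a10 a2L a20.
    exact: (isotopic_strongly_isotopic p_prime p_odd m_gt0 dimM m_even adm1 m_gt1
             nsB1 a10 nsB' a20 (fixL _ a2L)).
  move=> kk'; have [k'E|k'E] := exponents _ _ _ _ _ _ adm adm' nsB nsB' aL a0 a'L a'0 kk'.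
    by move: kk'; rewrite k'E; apply: same.
  have [_ a''L a''0 k'k] := dual _ _ _ adm' nsB' a'L a'0.
  have mk' : (m - k' = k)%N by have [] := adm; rewrite k'E; lia.
  move: a''L a''0 k'k; rewrite mk' => a''L a''0 k'k.
  apply: strongly_isotopic_trans (strongly_isotopic_sym k'k).
  apply: same => //; exact: isotopic_trans_strong kk' k'k.
- move=> k B a adm nsB aL a0 a'; have [adm' a'L a'0 kk'] := dual _ _ _ adm nsB aL a0.
  by split=> //; apply: strongly_isotopic_isotopic.
- move=> k B B' a adm nsB nsB' aL a0.
  have [a' [a'Q a'0 kk]] := mulS_change_base p_prime m_gt0 dimM m_even adm nsB nsB' a0 (fixL _ aL).
  by exists a'; split=> //; rewrite memL a'Q.
- move=> k B a a' adm nsB aL a0 a'L a'0 aa'.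
  apply: isotopic_trans_strong aa' _.
  exact: (mulS_opp p_prime p_odd m_gt0 dimM m_even adm nsB (fixL _ a'L)).
- move=> k B a adm nsB aL a0 s s_uniq sP; have [B0 _] := nsB.
  (* a code records the Frobenius twist and whether x and y are kept *)
  pose R (c : 'I_m * bool) (a' : M) :=
    @rescaling p m M k (if c.2 then B else B^-1) (if c.2 then a / B else (a / B)^-1)
      (B ^+ (p ^ c.1)) (a' ^+ (p ^ c.1) / B ^+ (p ^ c.1)).
  have -> : n = size (enum {: 'I_m * bool}).
    by rewrite -cardE card_prod card_ord card_bool mulnC.
  apply: (size_le_codes (R := R)) => // [a' /sP[a'L a'0 kk]|c x y Rx Ry].
    have [i D] := isotopic_rescaling p_prime p_odd m_gt0 dimM m_even adm m_gt1
      nsB a0 nsB a'0 (fixL _ a'L) kk.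
    by case: D => D; [exists (i, true) | exists (i, false)]; rewrite ?mem_enum.
  have b0 : (if c.2 then B else B^-1) != 0 by case: c.2; rewrite ?invr_eq0.
  have := rescaling_unique p_prime p_odd dimM adm b0 Rx Ry.
  by move/(mulIf (invr_neq0 (expf_neq0 _ B0)))/(frob_inj p_prime).
- move=> k k' B B' a a' adm adm' nsB nsB' aL a0 a'L a'0 kk'.
  by have [->|->] := exponents _ _ _ _ _ _ adm adm' nsB nsB' aL a0 a'L a'0 kk'; [left | right].
Qed.
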